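(* Let $n\ge3$ be odd. Let $Q$ be any choice of scalars $(t_{ij})$ and compatible bubble parameters $(c^{\pm}_{i,\lambda})$ for $\widehat{\mathfrak{sl}}_n$ as described in the context, with associated Kac--Moody 2-category $\mathcal U_Q(\widehat{\mathfrak{gl}}'_n)$. Then there does not exist a 2-isomorphism $\Xi\colon\mathcal U_Q(\widehat{\mathfrak{gl}}'_n)\to\tilde{\mathcal U}_\triangle(n)$ (an isomorphism of graded $\mathbb Q$-linear 2-categories) which is the identity on objects and on 1-morphisms.
   Context: **Weights.** Indices $i,j$ range over $\{1,\dots,n\}$, read modulo $n$. For $\lambda\in\mathbb Z^n$ put $\overline\lambda_i=\lambda_i-\lambda_{i+1}$ and $\overline\lambda=(\overline\lambda_1,\dots,\overline\lambda_n)$. Let $\alpha_i=e_i-e_{i+1}$ (so $\alpha_n=e_n-e_1$ and $\sum_i\alpha_i=0$), and $i\cdot j=(\alpha_i,\alpha_j)$ for the Euclidean form. **The 2-category $\mathcal U(t,c)$ attached to parameters.** Given scalars $t_{ij}\in\mathbb Q^\times$ and $c^\pm_{i,\lambda}\in\mathbb Q^\times$ ($\lambda\in\mathbb Z^n$) with $t_{ii}=\kappa\in\{1,-1\}$ independent of $i$, $c^+_{i,\lambda}c^-_{i,\lambda}=\kappa$, let $\mathcal U(t,c)$ be the following graded $\mathbb Q$-linear 2-category. Objects are $\lambda\in\mathbb Z^n$. 1-morphisms are finite formal direct sums of grading shifts $\langle r\rangle$ of composites of $\mathscr E_i\mathbf 1_\lambda\colon\lambda\to\lambda+\alpha_i$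 and $\mathscr F_i\mathbf 1_\lambda\colon\lambda\to\lambda-\alpha_i$. A 2-morphism $X\langle r\rangle\to Y\langle s\rangle$ is a combination of string diagrams of degree $s-r$ (read bottom to top; upward $i$-strands are $\mathscr E_i$, downward ones $\mathscr F_i$) generated by: - dots $x_i\colon\mathscr E_i\mathbf 1_\lambda\to\mathscr E_i\mathbf 1_\lambda\langle2\rangle$; - upward crossings $\tau_{ij}\colon\mathscr E_i\mathscr E_j\mathbf 1_\lambda\to\mathscr E_j\mathscr E_i\mathbf 1_\lambda\langle-i\cdot j\rangle$; - right cups $\mathbf 1_\lambda\to\mathscr F_i\mathscr E_i\mathbf 1_\lambda\langle1+\overline\lambda_i\rangle$ and left cups $\mathbf 1_\lambda\to\mathscr E_i\mathscr F_i\mathbf 1_\lambda\langle1-\overline\lambda_i\rangle$; - left caps $\mathscr F_i\mathscr E_i\mathbf 1_\lambda\to\mathbf 1_\lambda\langle1+\overline\lambda_i\rangle$ and right caps $\mathscr E_i\mathscr F_i\mathbf 1_\lambda\to\mathbf 1_\lambda\langle1-\overline\lambda_i\rangle$. Relations: 1. *Adjunction*: cups and caps satisfy all zigzag identities, so $\mathscr F_i$ is left and right adjoint to $\mathscr E_i$ up to shift. 2. *Cyclicity*: the two mates (180° rotations to the left and to the right, via cups and caps) of $x_i$ agree and define the dot on $\mathscr F_i$; the two mates of $\tau_{ij}$ agree and define the downward crossing $\mathscr F_i\mathscr F_j\to\mathscr F_j\mathscr F_i$. The sideways crossings $\mathscr E_i\mathscr F_j\to\mathscr F_j\mathscr E_i$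 and $\mathscr F_j\mathscr E_i\to\mathscr E_i\mathscr F_j$ are the 90° rotations of upward crossings; the two ways of rotating (from an upward or from a downward crossing) agree. 3. *Quadratic*: $\tau_{ji}\tau_{ij}$ on $\mathscr E_i\mathscr E_j\mathbf 1_\lambda$ is $0$ if $i=j$; $t_{ij}\,\mathrm{id}$ if $i\cdot j=0$; $t_{ij}\,(\text{dot on the }i\text{-strand})+t_{ji}\,(\text{dot on the }j\text{-strand})$ if $i\cdot j=-1$. 4. *Dot slide*: $\tau_{ij}(x_i\otimes1)-(1\otimes x_i)\tau_{ij}=(x_j\otimes1)\tau_{ij}-\tau_{ij}(1\otimes x_j)$, and this equals $\mathrm{id}$ if $i=j$ and $0$ if $i\ne j$. 5. *Cubic*: on $\mathscr E_i\mathscr E_j\mathscr E_k\mathbf 1_\lambda$, the triple crossing in which the middle strand passes to the left, minus the one in which it passes to the right, is $t_{ij}\,\mathrm{id}$ if $i=k$ and $i\cdot j=-1$, and $0$ otherwise. 6. *Bubbles*: the clockwise bubble $\mathrm{cw}_{i,m}(\lambda)$ is right cap $\circ$ ($\overline\lambda_i-1+m$ dots) $\circ$ left cup, and the counterclockwise bubble $\mathrm{ccw}_{i,m}(\lambda)$ is left cap $\circ$ ($-\overline\lambda_i-1+m$ dots) $\circ$ right cup, both endomorphisms of $\mathbf 1_\lambda$ of degree $2m$. They vanish for $m<0$, and $\mathrm{cw}_{i,0}(\lambda)=c^+_{i,\lambda}$, $\mathrm{ccw}_{i,0}(\lambda)=c^-_{i,\lambda}$. Bubbles with a negative number of dots (''fake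 bubbles'') are formal symbols defined by these values and by $\big(\sum_{m\ge0}\mathrm{ccw}_{i,m}(\lambda)u^m\big)\big(\sum_{m\ge0}\mathrm{cw}_{i,m}(\lambda)u^m\big)=\kappa$, which holds for all bubbles. 7. *Mixed*: for $i\ne j$ the composites of sideways crossings $\mathscr E_i\mathscr F_j\to\mathscr F_j\mathscr E_i\to\mathscr E_i\mathscr F_j$ and $\mathscr F_j\mathscr E_i\to\mathscr E_i\mathscr F_j\to\mathscr F_j\mathscr E_i$ are identities. For $i=j$, the first composite on $\mathscr E_i\mathscr F_i\mathbf 1_\lambda$ is $-\kappa\,\mathrm{id}+\sum_{a+b+c=\overline\lambda_i-1}(\text{left cup with }a\text{ dots})\circ\mathrm{ccw}_{i,c}(\lambda)\circ(\text{right cap with }b\text{ dots})$, and the second on $\mathscr F_i\mathscr E_i\mathbf 1_\lambda$ is $-\kappa\,\mathrm{id}+\sum_{a+b+c=-\overline\lambda_i-1}(\text{right cup with }a\text{ dots})\circ\mathrm{cw}_{i,c}(\lambda)\circ(\text{left cap with }b\text{ dots})$, where $a,b,c\ge0$. **The two 2-categories in the statement.** - A *choice of scalars and compatible bubble parameters $Q$ for $\widehat{\mathfrak{sl}}_n$* consists of $t_{ij}\in\mathbb Q^\times$ with $t_{ii}=1$ and $t_{ij}=t_{ji}$ whenever $j\not\equiv i\pm1\pmod n$, together with $c^\pm_{i,\lambda}\in\mathbb Q^\times$ depending on $\lambda$ only through $\overline\lambda$, such that $c^+_{i,\lambda}c^-_{i,\lambda}=1$ and $c^{\pm}_{i,\lambda+\alpha_j}=t_{ij}^{\pm1}c^{\pm}_{i,\lambda}$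 for all $i,j,\lambda$. Then $\mathcal U_Q(\widehat{\mathfrak{gl}}'_n)=\mathcal U(t,c)$ with $\kappa=1$. - $\tilde{\mathcal U}_\triangle(n)=\mathcal U(t,c)$ with $\kappa=-1$, for $t_{ii}=-1$, $t_{i,i+1}=-1$ (indices mod $n$), $t_{ij}=1$ otherwise, $c^+_{i,\lambda}=(-1)^{\lambda_{i+1}}$ and $c^-_{i,\lambda}=-c^+_{i,\lambda}$. *)

(* Defs.v *)
From HB Require Import structures.
From mathcomp Require Import all_boot all_order all_algebra.

Set Implicit Arguments.
Unset Strict Implicit.
Unset Printing Implicit Defensive.

Import Order.TTheory GRing.Theory Num.Theory.
Local Open Scope ring_scope.

(* Indices are 'I_n = {0, ..., n-1} instead of {1, ..., n}; "i + 1 modulo n" is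
   [ordS i].  All the data below is invariant under this relabelling. *)

Section Weights.
Variable n : nat.

Definition weight := 'rV[int]_n.

Definition alpha (i : 'I_n) : weight := delta_mx 0 i - delta_mx 0 (ordS i).

Definition ip (i j : 'I_n) : int := \sum_k alpha i 0 k * alpha j 0 k.

Definition bar (lam : weight) (i : 'I_n) : int := lam 0 i - lam 0 (ordS i).

(* A word [:: a; ...; z] is the composite a ... z 1_lam: the last letter is
   applied first.  1_lam itself is the empty word. *)
Definition letter := (bool * 'I_n)%type.
Definition E (i : 'I_n) : letter := (true, i).
Definition F (i : 'I_n) : letter := (false, i).
Definition word := seq letter.

Definition shift1 (a : letter) : weight := if a.1 then alpha a.2 else - alpha a.2.

(* The target of the 1-morphism with source lam given by the word w. *)
Definition act (w : word) (lam : weight) : weight :=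
  foldr (fun a mu => mu + shift1 a) lam w.

Lemma act_cat v w lam : act (v ++ w) lam = act v (act w lam).
Proof. by rewrite /act foldr_cat. Qed.

End Weights.

(* The parameters (t, c) on which U(t,c) depends; [cpar true] is c^+ and
   [cpar false] is c^-. *)
Record kmparam (n : nat) := KMParam {
  kappa : rat;
  tpar : 'I_n -> 'I_n -> rat;
  cpar : bool -> 'I_n -> weight n -> rat;
  kappaP : kappa = 1 \/ kappa = -1;
  tpar_neq0 : forall i j, tpar i j != 0;
  cpar_neq0 : forall b i lam, cpar b i lam != 0;
  tpar_diag : forall i, tpar i i = kappa;
  cpar_mul : forall i lam, cpar true i lam * cpar false i lam = kappa
}.

Section Diagrams.
Variable n : nat.

(* Raw expressions for linear combinations of string diagrams.  [Bub b i m] is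
   the bubble of degree 2m (clockwise if b, counterclockwise otherwise), real
   or fake.  [Zero u v d] is the zero 2-morphism u -> v of degree d. *)
Inductive tm : Type :=
| Id of word n
| Dot of 'I_n
| Cross of 'I_n & 'I_n
| RCup of 'I_n
| LCup of 'I_n
| LCap of 'I_n
| RCap of 'I_n
| Bub of bool & 'I_n & int
| Zero of word n & word n & int
| Add of tm & tm
| Scale of rat & tm
| VComp of tm & tm
| HComp of tm & tm.

End Diagrams.

(* Vertical (f below g) and horizontal (g to the left of f) composition. *)
Notation "g \vo f" := (VComp g f) (at level 45, right associativity).
Notation "g \ho f" := (HComp g f) (at level 42, right associativity).

(* [typed lam u v d f]: f is a well-formed homogeneous 2-morphism of degree d
   from u 1_lam to v 1_lam.  The rightmost region of the diagram is labelled
   lam, hence the left factor of a horizontal composite lives over the weight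
   [act v lam] of the region between the two factors. *)
Inductive typed (n : nat) :
    weight n -> word n -> word n -> int -> tm n -> Prop :=
| typed_id lam u : typed lam u u 0 (Id u)
| typed_dot lam i : typed lam [:: E i] [:: E i] 2 (Dot i)
| typed_cross lam i j :
    typed lam [:: E i; E j] [:: E j; E i] (- ip i j) (Cross i j)
| typed_rcup lam i : typed lam [::] [:: F i; E i] (1 + bar lam i) (RCup i)
| typed_lcup lam i : typed lam [::] [:: E i; F i] (1 - bar lam i) (LCup i)
| typed_lcap lam i : typed lam [:: F i; E i] [::] (1 + bar lam i) (LCap i)
| typed_rcap lam i : typed lam [:: E i; F i] [::] (1 - bar lam i) (RCap i)
| typed_bub lam b i m : typed lam [::] [::] (2 * m) (Bub b i m)
| typed_zero lam u v d : act u lam = act v lam -> typed lam u v d (Zero u v d)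
| typed_add lam u v d f g :
    typed lam u v d f -> typed lam u v d g -> typed lam u v d (Add f g)
| typed_scale lam u v d a f : typed lam u v d f -> typed lam u v d (Scale a f)
| typed_vcomp lam u v w d e g f :
    typed lam v w e g -> typed lam u v d f -> typed lam u w (d + e) (g \vo f)
| typed_hcomp lam u u' v v' d e g f :
    typed (act v lam) u u' d g -> typed lam v v' e f ->
    typed lam (u ++ v) (u' ++ v') (d + e) (g \ho f).

Section Abbreviations.
Variable n : nat.
Implicit Types (f g : tm n) (u v : word n) (i j k : 'I_n).

Definition Sub f g := Add f (Scale (-1) g).

Definition whisk u f v := Id u \ho f \ho Id v.

Definition dots i (m : nat) : tm n := iter m (fun f => Dot i \vo f) (Id [:: E i]).

(* The mates of the dot for the two adjunctions; both are the dot on F_i. *)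
Definition dotF_r i : tm n :=
  whisk [:: F i] (RCap i) [::]
  \vo whisk [:: F i] (Dot i) [:: F i]
  \vo whisk [::] (RCup i) [:: F i].
Definition dotF_l i : tm n :=
  whisk [::] (LCap i) [:: F i]
  \vo whisk [:: F i] (Dot i) [:: F i]
  \vo whisk [:: F i] (LCup i) [::].

(* The two mates F_i F_j -> F_j F_i of Cross i j. *)
Definition crossF_r i j : tm n :=
  whisk [:: F j; F i] (RCap j) [::]
  \vo whisk [:: F j; F i; E j] (RCap i) [:: F j]
  \vo whisk [:: F j; F i] (Cross i j) [:: F i; F j]
  \vo whisk [:: F j] (RCup i) [:: E j; F i; F j]
  \vo whisk [::] (RCup j) [:: F i; F j].
Definition crossF_l i j : tm n :=
  whisk [::] (LCap i) [:: F j; F i]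
  \vo whisk [:: F i] (LCap j) [:: E i; F j; F i]
  \vo whisk [:: F i; F j] (Cross i j) [:: F j; F i]
  \vo whisk [:: F i; F j; E i] (LCup j) [:: F i]
  \vo whisk [:: F i; F j] (LCup i) [::].

(* Sideways crossing E_i F_j -> F_j E_i, rotated from the upward crossing
   E_j E_i -> E_i E_j and from the downward crossing F_j F_i -> F_i F_j. *)
Definition crossEF i j : tm n :=
  whisk [:: F j; E i] (RCap j) [::]
  \vo whisk [:: F j] (Cross j i) [:: F j]
  \vo whisk [::] (RCup j) [:: E i; F j].
Definition crossEF_down i j : tm n :=
  whisk [::] (RCap i) [:: F j; E i]
  \vo whisk [:: E i] (crossF_r j i) [:: E i]
  \vo whisk [:: E i; F j] (RCup i) [::].

(* Sideways crossing F_j E_i -> E_i F_j, rotated from the upward crossing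
   E_i E_j -> E_j E_i and from the downward crossing F_i F_j -> F_j F_i. *)
Definition crossFE j i : tm n :=
  whisk [::] (LCap j) [:: E i; F j]
  \vo whisk [:: F j] (Cross i j) [:: F j]
  \vo whisk [:: F j; E i] (LCup j) [::].
Definition crossFE_down j i : tm n :=
  whisk [:: E i; F j] (LCap i) [::]
  \vo whisk [:: E i] (crossF_r i j) [:: E i]
  \vo whisk [::] (LCup i) [:: F j; E i].

(* \sum_(a + b + c = l - 1, a, b, c >= 0) G a b c, as an endomorphism of u of
   degree 0; every index is < |l|, and the sum is empty for l <= 0. *)
Definition triple_sum u (l : int) (G : nat -> nat -> nat -> tm n) : tm n :=
  \big[@Add n/Zero u u 0]_(a < `|l|%N)
  \big[@Add n/Zero u u 0]_(b < `|l|%N)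
  \big[@Add n/Zero u u 0]_(c < `|l|%N | (a + b + c)%N%:Z == l - 1) G a b c.

End Abbreviations.

(* The axioms of a strict Q-linear 2-category: they are only ever applied when
   both sides are well-formed, with the same source, target and degree. *)
Inductive struct_ax (n : nat) : tm n -> tm n -> Prop :=
| ax_addA f g h : struct_ax (Add f (Add g h)) (Add (Add f g) h)
| ax_addC f g : struct_ax (Add f g) (Add g f)
| ax_add0 u v d f : struct_ax (Add (Zero u v d) f) f
| ax_scaleA a b f : struct_ax (Scale a (Scale b f)) (Scale (a * b) f)
| ax_scale1 f : struct_ax (Scale 1 f) f
| ax_scale0 u v d f : struct_ax (Scale 0 f) (Zero u v d)
| ax_scaleDr a f g : struct_ax (Scale a (Add f g)) (Add (Scale a f) (Scale a g))
| ax_scaleDl a b f : struct_ax (Scale (a + b) f) (Add (Scale a f) (Scale b f))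
| ax_vcompA f g h : struct_ax (h \vo (g \vo f)) ((h \vo g) \vo f)
| ax_vcomp1l v f : struct_ax (Id v \vo f) f
| ax_vcomp1r u f : struct_ax (f \vo Id u) f
| ax_vcompDl f g h : struct_ax (Add g h \vo f) (Add (g \vo f) (h \vo f))
| ax_vcompDr f g h : struct_ax (h \vo Add f g) (Add (h \vo f) (h \vo g))
| ax_vcompZl a f g : struct_ax (Scale a g \vo f) (Scale a (g \vo f))
| ax_vcompZr a f g : struct_ax (g \vo Scale a f) (Scale a (g \vo f))
| ax_hcompA f g h : struct_ax (h \ho (g \ho f)) ((h \ho g) \ho f)
| ax_hcomp1l f : struct_ax (Id [::] \ho f) f
| ax_hcomp1r f : struct_ax (f \ho Id [::]) f
| ax_hcompDl f g h : struct_ax (Add g h \ho f) (Add (g \ho f) (h \ho f))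
| ax_hcompDr f g h : struct_ax (h \ho Add f g) (Add (h \ho f) (h \ho g))
| ax_hcompZl a f g : struct_ax (Scale a g \ho f) (Scale a (g \ho f))
| ax_hcompZr a f g : struct_ax (g \ho Scale a f) (Scale a (g \ho f))
| ax_hcomp_id u v : struct_ax (Id u \ho Id v) (Id (u ++ v))
| ax_interchange f f' g g' :
    struct_ax ((g' \ho f') \vo (g \ho f)) ((g' \vo g) \ho (f' \vo f)).

(* The defining relations of U(t,c), in a diagram with rightmost region lam. *)
Inductive km_rel (n : nat) (P : kmparam n) (lam : weight n) :
    tm n -> tm n -> Prop :=
| zigzag_E_right i :
    km_rel P lam (whisk [::] (RCap i) [:: E i] \vo whisk [:: E i] (RCup i) [::])
                 (Id [:: E i])
| zigzag_F_right i :
    km_rel P lam (whisk [:: F i] (RCap i) [::] \vo whisk [::] (RCup i) [:: F i])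
                 (Id [:: F i])
| zigzag_E_left i :
    km_rel P lam (whisk [:: E i] (LCap i) [::] \vo whisk [::] (LCup i) [:: E i])
                 (Id [:: E i])
| zigzag_F_left i :
    km_rel P lam (whisk [::] (LCap i) [:: F i] \vo whisk [:: F i] (LCup i) [::])
                 (Id [:: F i])
| cyclic_dot i : km_rel P lam (dotF_r i) (dotF_l i)
| cyclic_cross i j : km_rel P lam (crossF_r i j) (crossF_l i j)
| cyclic_EF i j : km_rel P lam (crossEF i j) (crossEF_down i j)
| cyclic_FE i j : km_rel P lam (crossFE j i) (crossFE_down j i)
| quadratic_eq i :
    km_rel P lam (Cross i i \vo Cross i i)
                 (Zero [:: E i; E i] [:: E i; E i] (- ip i i + - ip i i))
| quadratic_far i j : ip i j = 0 ->
    km_rel P lam (Cross j i \vo Cross i j) (Scale (tpar P i j) (Id [:: E i; E j]))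
| quadratic_near i j : ip i j = -1 ->
    km_rel P lam (Cross j i \vo Cross i j)
                 (Add (Scale (tpar P i j) (whisk [::] (Dot i) [:: E j]))
                      (Scale (tpar P j i) (whisk [:: E i] (Dot j) [::])))
| dot_slide_left_eq i :
    km_rel P lam (Sub (Cross i i \vo whisk [::] (Dot i) [:: E i])
                      (whisk [:: E i] (Dot i) [::] \vo Cross i i))
                 (Id [:: E i; E i])
| dot_slide_right_eq i :
    km_rel P lam (Sub (whisk [::] (Dot i) [:: E i] \vo Cross i i)
                      (Cross i i \vo whisk [:: E i] (Dot i) [::]))
                 (Id [:: E i; E i])
| dot_slide_left_neq i j : i != j ->
    km_rel P lam (Sub (Cross i j \vo whisk [::] (Dot i) [:: E j])
                      (whisk [:: E j] (Dot i) [::] \vo Cross i j))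
                 (Zero [:: E i; E j] [:: E j; E i] (2 - ip i j))
| dot_slide_right_neq i j : i != j ->
    km_rel P lam (Sub (whisk [::] (Dot j) [:: E i] \vo Cross i j)
                      (Cross i j \vo whisk [:: E i] (Dot j) [::]))
                 (Zero [:: E i; E j] [:: E j; E i] (2 - ip i j))
| cubic_near i j : ip i j = -1 ->
    km_rel P lam
      (Sub (whisk [::] (Cross j i) [:: E i]
            \vo whisk [:: E j] (Cross i i) [::]
            \vo whisk [::] (Cross i j) [:: E i])
           (whisk [:: E i] (Cross i j) [::]
            \vo whisk [::] (Cross i i) [:: E j]
            \vo whisk [:: E i] (Cross j i) [::]))
      (Scale (tpar P i j) (Id [:: E i; E j; E i]))
| cubic_other i j k : ~~ ((i == k) && (ip i j == -1)) ->
    km_rel P lam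
      (Sub (whisk [::] (Cross j k) [:: E i]
            \vo whisk [:: E j] (Cross i k) [::]
            \vo whisk [::] (Cross i j) [:: E k])
           (whisk [:: E k] (Cross i j) [::]
            \vo whisk [::] (Cross i k) [:: E j]
            \vo whisk [:: E i] (Cross j k) [::]))
      (Zero [:: E i; E j; E k] [:: E k; E j; E i]
            (- ip i j + - ip i k + - ip j k))
(* The next two relations identify [Bub b i m] with an actual diagram when the
   number d of dots is nonnegative; the other symbols are the fake bubbles. *)
| bubble_cw i (d : nat) :
    km_rel P lam (RCap i \vo whisk [::] (dots i d) [:: F i] \vo LCup i)
                 (Bub true i (d%:Z + 1 - bar lam i))
| bubble_ccw i (d : nat) :
    km_rel P lam (LCap i \vo whisk [:: F i] (dots i d) [::] \vo RCup i)
                 (Bub false i (d%:Z + 1 + bar lam i))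
| bubble_neg b i (m : int) : m < 0 ->
    km_rel P lam (Bub b i m) (Zero [::] [::] (2 * m))
| bubble_0 b i :
    km_rel P lam (Bub b i 0) (Scale (cpar P b i lam) (Id [::]))
| bubble_series i (m : nat) :
    km_rel P lam
      (\big[@Add n/Zero [::] [::] (2 * m%:Z)]_(a < m.+1)
          (Bub false i a%:Z \vo Bub true i (m - a)%N%:Z))
      (if m == 0%N then Scale (kappa P) (Id [::]) else Zero [::] [::] (2 * m%:Z))
| mixed_EF i j : i != j ->
    km_rel P lam (crossFE j i \vo crossEF i j) (Id [:: E i; F j])
| mixed_FE i j : i != j ->
    km_rel P lam (crossEF i j \vo crossFE j i) (Id [:: F j; E i])
| mixed_EF_eq i :
    km_rel P lam (crossFE i i \vo crossEF i i)
      (Add (Scale (- kappa P) (Id [:: E i; F i]))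
           (triple_sum [:: E i; F i] (bar lam i) (fun a b c =>
              (whisk [::] (dots i a) [:: F i] \vo LCup i)
              \vo Bub false i c%:Z
              \vo (RCap i \vo whisk [::] (dots i b) [:: F i]))))
| mixed_FE_eq i :
    km_rel P lam (crossEF i i \vo crossFE i i)
      (Add (Scale (- kappa P) (Id [:: F i; E i]))
           (triple_sum [:: F i; E i] (- bar lam i) (fun a b c =>
              (whisk [:: F i] (dots i a) [::] \vo RCup i)
              \vo Bub true i c%:Z
              \vo (LCap i \vo whisk [:: F i] (dots i b) [::])))).

(* Equality of homogeneous 2-morphisms u 1_lam -> v 1_lam of degree d in
   U(t,c): the congruence generated by the axioms and relations above. *)
Inductive eqv (n : nat) (P : kmparam n) :
    weight n -> word n -> word n -> int -> tm n -> tm n -> Prop :=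
| eqv_struct lam u v d f g : struct_ax f g ->
    typed lam u v d f -> typed lam u v d g -> eqv P lam u v d f g
| eqv_km lam u v d f g : km_rel P lam f g ->
    typed lam u v d f -> typed lam u v d g -> eqv P lam u v d f g
| eqv_refl lam u v d f : typed lam u v d f -> eqv P lam u v d f f
| eqv_sym lam u v d f g : eqv P lam u v d f g -> eqv P lam u v d g f
| eqv_trans lam u v d f g h :
    eqv P lam u v d f g -> eqv P lam u v d g h -> eqv P lam u v d f h
| eqv_add lam u v d f f' g g' : eqv P lam u v d f f' -> eqv P lam u v d g g' ->
    eqv P lam u v d (Add f g) (Add f' g')
| eqv_scale lam u v d a f f' : eqv P lam u v d f f' ->
    eqv P lam u v d (Scale a f) (Scale a f')
| eqv_vcomp lam u v w d e f f' g g' :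
    eqv P lam v w e g g' -> eqv P lam u v d f f' ->
    eqv P lam u w (d + e) (g \vo f) (g' \vo f')
| eqv_hcomp lam u u' v v' d e f f' g g' :
    eqv P (act v lam) u u' d g g' -> eqv P lam v v' e f f' ->
    eqv P lam (u ++ v) (u' ++ v') (d + e) (g \ho f) (g' \ho f').

Section TwoCategory.
Variable n : nat.
Implicit Types lam mu nu : weight n.

(* A 1-morphism lam -> mu: a finite formal direct sum of shifts w<r>. *)
Record mor1 lam mu := Mor1 {
  summands :> seq (word n * int);
  summandsP : all (fun x => act x.1 lam == mu) summands
}.

Definition wd lam mu (X : mor1 lam mu) (i : nat) : word n :=
  (nth ([::], 0) X i).1.
Definition sh lam mu (X : mor1 lam mu) (i : nat) : int :=
  (nth ([::], 0) X i).2.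

Lemma act_wd lam mu (X : mor1 lam mu) i :
  (i < size X)%N -> act (wd X i) lam = mu.
Proof. by move=> lti; apply/eqP/(all_nthP ([::], 0) (summandsP X)). Qed.

Fact comp1_subproof lam mu nu (Y : mor1 mu nu) (X : mor1 lam mu) :
  all (fun x => act x.1 lam == nu)
      [seq (y.1 ++ x.1, y.2 + x.2) | y <- Y, x <- X].
Proof.
apply/all_allpairsP => y x yY xX /=.
rewrite act_cat (eqP (allP (summandsP X) _ xX)).
exact: (allP (summandsP Y) _ yY).
Qed.

Definition comp1 lam mu nu (Y : mor1 mu nu) (X : mor1 lam mu) : mor1 lam nu :=
  Mor1 (comp1_subproof Y X).

Lemma nth_comp1 lam mu nu (Y : mor1 mu nu) (X : mor1 lam mu) i :
  (i < size (comp1 Y X))%N ->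
  [/\ (i %/ size X < size Y)%N, (i %% size X < size X)%N,
      wd (comp1 Y X) i = wd Y (i %/ size X) ++ wd X (i %% size X) &
      sh (comp1 Y X) i = sh Y (i %/ size X) + sh X (i %% size X)].
Proof.
rewrite size_allpairs => lti.
have X0 : (0 < size X)%N by case: (size X) lti => //; rewrite muln0.
have lt1 : (i %/ size X < size Y)%N by rewrite ltn_divLR.
have lt2 : (i %% size X < size X)%N by rewrite ltn_mod.
rewrite /wd /sh /=.
suff -> : nth ([::], 0) [seq (y.1 ++ x.1, y.2 + x.2) | y <- Y, x <- X] i =
  (fun y x : word n * int => (y.1 ++ x.1, y.2 + x.2))
    (nth ([::], 0) Y (i %/ size X)) (nth ([::], 0) X (i %% size X)) by split.
elim: (Y : seq _) i {lti lt1 lt2} (lti) => [|y Y' IH] i /=; first by rewrite mul0n.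
rewrite mulSn nth_cat size_map => lti.
case: ltnP => [ltiX | leXi].
  by rewrite divn_small // modn_small //= (nth_map ([::], 0)).
rewrite IH; last by rewrite ltn_subLR.
have -> : (i = (i - size X) + size X)%N by rewrite subnK.
by rewrite addnK divnDr // divnn X0 addn1 modnDr.
Qed.

(* A 2-morphism X -> Y: a matrix whose entry (j, i) goes from the i-th summand
   u<r> of X to the j-th summand v<s> of Y, and has degree s - r.  Entries out
   of range are irrelevant; see [eq2]. *)
Record mor2 lam mu (X Y : mor1 lam mu) := Mor2 {
  entry :> nat -> nat -> tm n;
  entryP : forall i j, (i < size X)%N -> (j < size Y)%N ->
    typed lam (wd X i) (wd Y j) (sh Y j - sh X i) (entry j i)
}.

(* Equality of 2-morphisms in U(t,c): the hom-sets of U(t,c) are the quotients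
   of the types [mor2 X Y] by this relation. *)
Definition eq2 (P : kmparam n) lam mu (X Y : mor1 lam mu) (f g : mor2 X Y) :=
  forall i j, (i < size X)%N -> (j < size Y)%N ->
    eqv P lam (wd X i) (wd Y j) (sh Y j - sh X i) (f j i) (g j i).

Fact add2_subproof lam mu (X Y : mor1 lam mu) (f g : mor2 X Y) i j :
  (i < size X)%N -> (j < size Y)%N ->
  typed lam (wd X i) (wd Y j) (sh Y j - sh X i) (Add (f j i) (g j i)).
Proof. by move=> Hi Hj; apply: typed_add; apply: entryP. Qed.

Definition add2 lam mu (X Y : mor1 lam mu) (f g : mor2 X Y) : mor2 X Y :=
  Mor2 (add2_subproof f g).

Fact scale2_subproof lam mu (X Y : mor1 lam mu) a (f : mor2 X Y) i j :
  (i < size X)%N -> (j < size Y)%N ->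
  typed lam (wd X i) (wd Y j) (sh Y j - sh X i) (Scale a (f j i)).
Proof. by move=> Hi Hj; apply: typed_scale; apply: entryP. Qed.

Definition scale2 lam mu (X Y : mor1 lam mu) (a : rat) (f : mor2 X Y) :
  mor2 X Y := Mor2 (scale2_subproof a f).

Fact id2_subproof lam mu (X : mor1 lam mu) i j :
  (i < size X)%N -> (j < size X)%N ->
  typed lam (wd X i) (wd X j) (sh X j - sh X i)
    (if i == j then Id (wd X i) else Zero (wd X i) (wd X j) (sh X j - sh X i)).
Proof.
move=> Hi Hj; case: eqP => [<-|_]; first by rewrite subrr; apply: typed_id.
by apply: typed_zero; rewrite !act_wd.
Qed.

Definition id2 lam mu (X : mor1 lam mu) : mor2 X X := Mor2 (@id2_subproof _ _ X).

Fact vcomp2_subproof lam mu (X Y Z : mor1 lam mu)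
    (g : mor2 Y Z) (f : mor2 X Y) i k :
  (i < size X)%N -> (k < size Z)%N ->
  typed lam (wd X i) (wd Z k) (sh Z k - sh X i)
    (\big[@Add n/Zero (wd X i) (wd Z k) (sh Z k - sh X i)]_(j < size Y)
        (g k j \vo f j i)).
Proof.
move=> Hi Hk; elim/big_ind: _ => [|a b|j _]; first by apply: typed_zero; rewrite !act_wd.
  exact: typed_add.
have -> : sh Z k - sh X i = (sh Y j - sh X i) + (sh Z k - sh Y j).
  by rewrite [RHS]addrC addrA subrK.
by apply: typed_vcomp; apply: entryP.
Qed.

Definition vcomp2 lam mu (X Y Z : mor1 lam mu) (g : mor2 Y Z) (f : mor2 X Y) :
  mor2 X Z := Mor2 (vcomp2_subproof g f).

(* The Kronecker product, for the ordering of the summands of [comp1]. *)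
Fact hcomp2_subproof lam mu nu (Y Y' : mor1 mu nu) (X X' : mor1 lam mu)
    (g : mor2 Y Y') (f : mor2 X X') i j :
  (i < size (comp1 Y X))%N -> (j < size (comp1 Y' X'))%N ->
  typed lam (wd (comp1 Y X) i) (wd (comp1 Y' X') j)
    (sh (comp1 Y' X') j - sh (comp1 Y X) i)
    (g (j %/ size X')%N (i %/ size X)%N \ho f (j %% size X')%N (i %% size X)%N).
Proof.
move=> /nth_comp1[Hi1 Hi2 -> ->] /nth_comp1[Hj1 Hj2 -> ->].
rewrite opprD addrACA; apply: typed_hcomp; last exact: entryP.
by rewrite act_wd //; apply: entryP.
Qed.

Definition hcomp2 lam mu nu (Y Y' : mor1 mu nu) (X X' : mor1 lam mu)
    (g : mor2 Y Y') (f : mor2 X X') : mor2 (comp1 Y X) (comp1 Y' X') :=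
  Mor2 (hcomp2_subproof g f).

(* Q-linear strict 2-functors U(t,c) -> U(t',c') which are the identity on
   objects and on 1-morphisms.  They preserve degrees, since [mor2 X Y] only
   contains the matrices of the prescribed degrees, and they commute with the
   grading shift, which is horizontal composition with the identity of
   1_mu<r>. *)
Record twofunctor (P P' : kmparam n) := TwoFunctor {
  fun2 :> forall lam mu (X Y : mor1 lam mu), mor2 X Y -> mor2 X Y;
  fun2_ext : forall lam mu (X Y : mor1 lam mu) (f g : mor2 X Y),
    eq2 P f g -> eq2 P' (fun2 f) (fun2 g);
  fun2_add : forall lam mu (X Y : mor1 lam mu) (f g : mor2 X Y),
    eq2 P' (fun2 (add2 f g)) (add2 (fun2 f) (fun2 g));
  fun2_scale : forall lam mu (X Y : mor1 lam mu) (a : rat) (f : mor2 X Y),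
    eq2 P' (fun2 (scale2 a f)) (scale2 a (fun2 f));
  fun2_id : forall lam mu (X : mor1 lam mu), eq2 P' (fun2 (id2 X)) (id2 X);
  fun2_vcomp : forall lam mu (X Y Z : mor1 lam mu) (g : mor2 Y Z) (f : mor2 X Y),
    eq2 P' (fun2 (vcomp2 g f)) (vcomp2 (fun2 g) (fun2 f));
  fun2_hcomp : forall lam mu nu (Y Y' : mor1 mu nu) (X X' : mor1 lam mu)
      (g : mor2 Y Y') (f : mor2 X X'),
    eq2 P' (fun2 (hcomp2 g f)) (hcomp2 (fun2 g) (fun2 f))
}.

Definition is_2isomorphism (P P' : kmparam n) (Xi : twofunctor P P') : Prop :=
  exists Psi : twofunctor P' P,
    (forall lam mu (X Y : mor1 lam mu) (f : mor2 X Y), eq2 P (Psi _ _ _ _ (Xi _ _ _ _ f)) f) /\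
    (forall lam mu (X Y : mor1 lam mu) (f : mor2 X Y), eq2 P' (Xi _ _ _ _ (Psi _ _ _ _ f)) f).

End TwoCategory.

(* Choices of scalars and compatible bubble parameters for affine sl_n;
   [bubble true] is c^+ and [bubble false] is c^-. *)
Record scalar_choice (n : nat) := ScalarChoice {
  scal : 'I_n -> 'I_n -> rat;
  bubble : bool -> 'I_n -> weight n -> rat;
  scal_neq0 : forall i j, scal i j != 0;
  scal_diag : forall i, scal i i = 1;
  scal_sym : forall i j, j != ordS i -> i != ordS j -> scal i j = scal j i;
  bubble_neq0 : forall b i lam, bubble b i lam != 0;
  bubble_bar : forall b i lam mu, bar lam =1 bar mu -> bubble b i lam = bubble b i mu;
  bubble_mul : forall i lam, bubble true i lam * bubble false i lam = 1;
  bubble_compat_cw : forall i j lam,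
    bubble true i (lam + alpha j) = scal i j * bubble true i lam;
  bubble_compat_ccw : forall i j lam,
    bubble false i (lam + alpha j) = (scal i j)^-1 * bubble false i lam
}.

Definition UQ (n : nat) (Q : scalar_choice n) : kmparam n :=
  @KMParam n 1 (scal Q) (bubble Q) (or_introl (erefl 1))
    (@scal_neq0 n Q) (@bubble_neq0 n Q) (@scal_diag n Q) (@bubble_mul n Q).

Section Utilde.
Variable n : nat.

Definition tilde_t (i j : 'I_n) : rat :=
  if (j == i) || (j == ordS i) then -1 else 1.

Definition tilde_c (b : bool) (i : 'I_n) (lam : weight n) : rat :=
  if b then (-1) ^ lam 0 (ordS i) else - (-1) ^ lam 0 (ordS i).

Fact tilde_t_neq0 i j : tilde_t i j != 0.
Proof. by rewrite /tilde_t; case: ifP. Qed.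

Fact tilde_c_neq0 b i lam : tilde_c b i lam != 0.
Proof. by rewrite /tilde_c; case: b; rewrite ?oppr_eq0 expfz_neq0. Qed.

Fact tilde_t_diag i : tilde_t i i = -1.
Proof. by rewrite /tilde_t eqxx. Qed.

Fact tilde_c_mul i lam : tilde_c true i lam * tilde_c false i lam = -1.
Proof. by rewrite /tilde_c mulrN -exprMz_comm ?mulrNN ?mulr1 ?exp1rz. Qed.

Definition Utilde : kmparam n :=
  @KMParam n (-1) tilde_t tilde_c (or_intror (erefl (-1)))
    tilde_t_neq0 tilde_c_neq0 tilde_t_diag tilde_c_mul.

End Utilde.

(* Main.v *)
Require Import Defs.
From mathcomp Require Import all_boot all_order all_algebra.
From mathcomp Require Import zify ring.

(* The natural representation puts Q on the weights e_1, ..., e_n and 0 on all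
   the others; each E_i and F_i between two of these weights is the identity,
   dots, cups and caps act by 1 and crossings by 0.  This is a representation of
   the target 2-category (with the grading forgotten).  Pull it back along Xi
   and let a_j be the scalar by which the dot acts on E_j 1_{e_{j+1}}.  Since
   E_{j+1} E_j kills the weight e_{j+2}, the quadratic relation reads
     t_{j,j+1} a_j + t_{j+1,j} a_{j+1} = 0.
   The roots sum to 0, so the compatibility of c^+ with t forces
   prod_j t_ij = 1 for every i; hence prod_j t_{j,j+1} and prod_j t_{j+1,j} have
   the same sign, and since n is odd, going once around the cycle gives a_j = 0
   for all j.  The bubble relations then show that every 2-morphism of nonzero
   degree acts by 0.  But the preimage of a dot under Xi has degree 2 and acts
   by 1. *)

Section NoTwoIsomorphism.
Set Implicit Arguments.
Unset Strict Implicit.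
Unset Printing Implicit Defensive.
Import Order.TTheory GRing.Theory Num.Theory.
Local Open Scope ring_scope.

Variable n : nat.
Implicit Types (lam mu : weight n) (u v w : word n) (i j k : 'I_n).

(** * The natural representation of the target *)

Definition fund k : weight n := delta_mx 0 k.
Definition vertex lam : bool := [exists k, lam == fund k].

Lemma vertexP lam : reflect (exists k, lam = fund k) (vertex lam).
Proof.
by apply: (iffP existsP) => -[k]; [move/eqP=> ->|move=> ->]; exists k.
Qed.

Lemma vertex_fund k : vertex (fund k).
Proof. by apply/vertexP; exists k. Qed.

Lemma fundE k i : fund k 0 i = (k == i)%:R.
Proof. by rewrite mxE eqxx eq_sym. Qed.

Lemma fund_inj : injective fund.
Proof.
move=> j k /(congr1 (fun m : weight n => m 0 k)); rewrite !fundE eqxx.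
by case: eqP.
Qed.

Hypothesis n_ge3 : (3 <= n)%N.

(** * Cyclic indices, roots and weights *)

Lemma ordS_neq i : ordS i != i.
Proof.
rewrite -val_eqE /=; have := ltn_ord i; case: (ltngtP i.+1 n) => // [lt|eq] _.
  by rewrite modn_small //; lia.
by rewrite eq modnn; lia.
Qed.

Lemma ordS_eqF i : (ordS i == i) = false.
Proof. exact: negPf (ordS_neq i). Qed.

Lemma ordS_eqFr i : (i == ordS i) = false.
Proof. by rewrite eq_sym ordS_eqF. Qed.

(** Since [n >= 3], the two neighbours of an index are distinct, so adjacency has a direction. *)
Lemma ordSS_neq i : ordS (ordS i) != i.
Proof.
rewrite -val_eqE /=; have := ltn_ord i; case: (ltngtP i.+1 n) => // [lt|eq] _.
  rewrite (modn_small lt); case: (ltngtP i.+2 n) lt => // [lt _|eq _].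
    by rewrite modn_small //; lia.
  by rewrite eq modnn; lia.
by rewrite eq modnn modn_small //; lia.
Qed.

Lemma alphaE i k : alpha i 0 k = (i == k)%:R - (ordS i == k)%:R.
Proof. by rewrite !mxE eqxx /= !(eq_sym k). Qed.

Lemma fund_alpha i : fund (ordS i) + alpha i = fund i.
Proof. by rewrite addrCA subrr addr0. Qed.

Lemma bar_fund k i : bar (fund k) i = (k == i)%:R - (k == ordS i)%:R.
Proof. by rewrite /bar !fundE. Qed.

Lemma vertex_ge0 lam i : vertex lam -> 0 <= lam 0 i.
Proof. by case/vertexP=> k ->; rewrite fundE; case: (k == i). Qed.

(** Adding [alpha i] lowers the coordinate at [ordS i] by one, and no [e_k] has a negative
    coordinate. *)
Lemma vertexD lam i :
  vertex lam -> vertex (lam + alpha i) -> lam = fund (ordS i).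
Proof.
case/vertexP=> k -> /(vertex_ge0 (ordS i)).
rewrite mxE fundE alphaE. rewrite eqxx ordS_eqFr.
by case: eqP => [->|].
Qed.

Lemma vertexB lam i : vertex lam -> vertex (lam - alpha i) -> lam = fund i.
Proof.
case/vertexP=> k -> /(vertex_ge0 i).
have -> : (fund k - alpha i) 0 i = (k == i)%:R - 1.
  by rewrite mxE fundE mxE alphaE eqxx ordS_eqF subr0.
by case: eqP => [->|].
Qed.

Lemma vertexD_bar lam i :
  vertex lam -> vertex (lam + alpha i) = (bar lam i == -1).
Proof.
move=> lamV; apply/idP/eqP => [/(vertexD lamV)->|].
  by rewrite bar_fund eqxx ordS_eqF.
case/vertexP: lamV => k ->; rewrite bar_fund.
case: (k =P ordS i) => [->|_]; last by case: eqP.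
by rewrite fund_alpha vertex_fund.
Qed.

Lemma vertexB_bar lam i :
  vertex lam -> vertex (lam - alpha i) = (bar lam i == 1).
Proof.
move=> lamV; apply/idP/eqP => [/(vertexB lamV)->|].
  by rewrite bar_fund eqxx ordS_eqFr.
case/vertexP: lamV => k ->; rewrite bar_fund.
case: (k =P i) => [->|_]; last by case: eqP.
by rewrite -{1}(fund_alpha i) addrK vertex_fund.
Qed.

(** The coordinate at [ordS i] is recorded too because it is the exponent of the sign in
    [tilde_c]. *)
Lemma vertex_bar lam i : vertex lam ->
  [\/ bar lam i = 1 /\ lam 0 (ordS i) = 0,
      bar lam i = 0 /\ lam 0 (ordS i) = 0 |
      bar lam i = -1 /\ lam 0 (ordS i) = 1].
Proof.
case/vertexP=> k ->; rewrite bar_fund fundE.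
case: (k =P i) => [->|_].
  by rewrite ordS_eqFr; constructor 1.
by case: eqP; [constructor 3|constructor 2].
Qed.

Lemma ipE i j : ip i j = (i == j)%:R *+ 2 - (i == ordS j)%:R - (ordS i == j)%:R.
Proof.
rewrite /ip; under eq_bigr => k _ do rewrite alphaE mulrBl.
rewrite big_split sumrN /= (bigD1 i) //= [X in _ + X - _]big1 => [|k /negPf].
  rewrite (bigD1 (ordS i)) //= [X in - (_ + X)]big1 => [|k /negPf].
    rewrite !eqxx !mul1r !addr0 !alphaE (inj_eq (@ordS_inj n)).
    by rewrite !(eq_sym j) (eq_sym (ordS j)); ring.
  by rewrite eq_sym => ->; rewrite mul0r.
by rewrite eq_sym => ->; rewrite mul0r.
Qed.

Lemma ip_ordS i : ip i (ordS i) = -1.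
Proof.
rewrite ipE eqxx ordS_eqFr (eq_sym i).
by rewrite (negPf (ordSS_neq i)).
Qed.

(** * Words that stay on the weights [e_k] *)

(** The natural representation sends [u] over [lam] to Q if all weights met by [u], both ends
    included, are among the [e_k], and to 0 otherwise; [live] is the first case. *)
Fixpoint live u lam : bool :=
  if u is a :: u' then live u' lam && vertex (act u lam) else vertex lam.

Lemma live_src u lam : live u lam -> vertex lam.
Proof. by elim: u => //= a u IH /andP[/IH]. Qed.

Lemma live_tgt u lam : live u lam -> vertex (act u lam).
Proof. by case: u => //= a u /andP[]. Qed.

Lemma live_cat u v lam : live (u ++ v) lam = live u (act v lam) && live v lam.
Proof.
elim: u => [|a u IH] /=; last first.
  by rewrite IH act_cat -andbA (andbC (live v _)) andbA.
by case: (boolP (live v lam)) => [/live_tgt->|]; rewrite ?andbF.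
Qed.

Lemma live_E i lam : live [:: E i] lam -> lam = fund (ordS i).
Proof. by case/andP=> lamV /(vertexD lamV). Qed.

Lemma live_F i lam : live [:: F i] lam -> lam = fund i.
Proof. by case/andP=> lamV /(vertexB lamV). Qed.

Lemma act_E i : act [:: E i] (fund (ordS i)) = fund i.
Proof. exact: fund_alpha. Qed.

Lemma act_F i : act [:: F i] (fund i) = fund (ordS i).
Proof. by rewrite -{1}fund_alpha /= addrK. Qed.

Lemma live_fund_E i : live [:: E i] (fund (ordS i)).
Proof. by rewrite /live act_E !vertex_fund. Qed.

(** [E j] ends at [e_j], and [E i] is nonzero only on [e_(i+1)]. *)
Lemma live_EE i j lam : live [:: E i; E j] lam ->
  j = ordS i /\ lam = fund (ordS j).
Proof.
rewrite -[[:: E i; E j]]/([:: E i] ++ [:: E j]) live_cat.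
case/andP=> [+ /live_E lamE].
by rewrite lamE act_E => /live_E/fund_inj.
Qed.

Lemma live_fund_EE i : live [:: E i; E (ordS i)] (fund (ordS (ordS i))).
Proof.
rewrite -[[:: E i; _]]/([:: E i] ++ [:: E (ordS i)]) live_cat act_E.
by rewrite !live_fund_E.
Qed.

Lemma live_EF i j lam : live [:: E i; F j] lam -> i = j.
Proof.
rewrite -[[:: E i; F j]]/([:: E i] ++ [:: F j]) live_cat.
case/andP=> [+ /live_F lamE].
by rewrite lamE act_F => /live_E/fund_inj/ordS_inj.
Qed.

Lemma live_FE i j lam : live [:: F j; E i] lam -> i = j.
Proof.
rewrite -[[:: F j; E i]]/([:: F j] ++ [:: E i]) live_cat.
case/andP=> [+ /live_E lamE].
by rewrite lamE act_E => /live_F/fund_inj.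
Qed.

(** The word survives only where its cup and cap, of degree [1 - bar lam i], have degree 0. *)
Lemma live_EF_bar i lam :
  live [:: E i; F i] lam = vertex lam && (bar lam i == 1).
Proof.
rewrite /= addrNK; case: (boolP (vertex lam)) => //= lamV.
by rewrite (vertexB_bar _ lamV) andbT.
Qed.

Lemma live_FE_bar i lam :
  live [:: F i; E i] lam = vertex lam && (bar lam i == -1).
Proof.
rewrite /= addrK; case: (boolP (vertex lam)) => //= lamV.
by rewrite (vertexD_bar _ lamV) andbT.
Qed.

(* Junk on ill-formed expressions. *)
Fixpoint src (f : tm n) : word n :=
  match f with
  | Id u => u
  | Defs.Dot i => [:: E i]
  | Cross i j => [:: E i; E j]
  | LCap i => [:: F i; E i]
  | RCap i => [:: E i; F i]
  | RCup _ | LCup _ | Bub _ _ _ => [::]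
  | Zero u _ _ => u
  | Add f _ | Scale _ f | VComp _ f => src f
  | HComp g f => src g ++ src f
  end.

(* The bubbles on the line of weight lam, for [l = bar lam i]: the clockwise and
   counterclockwise series are (1 - u)^-1 and u - 1 if l = 1, u - 1 and
   (1 - u)^-1 if l = -1, and the constants 1 and -1 if l = 0. *)
Definition bub (b : bool) (l m : int) : rat :=
  if l == (if b then 1 else -1) then if 0 <= m then 1 else 0
  else if m == 0 then if b && (l == 0) then 1 else -1
  else if (m == 1) && (l != 0) then 1 else 0.

(** The scalar of [f] between spaces of dimension at most one. Raw expressions carry no weights, so
    the weight to the left of [f] is computed from [src f]. *)
Fixpoint ev lam (f : tm n) : rat :=
  match f with
  | Id u => (live u lam)%:R
  | Defs.Dot i => (live [:: E i] lam)%:R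
  | Cross _ _ | Zero _ _ _ => 0
  | RCup i | LCap i => (live [:: F i; E i] lam)%:R
  | LCup i | RCap i => (live [:: E i; F i] lam)%:R
  | Bub b i m => (vertex lam)%:R * bub b (bar lam i) m
  | Add f g => ev lam f + ev lam g
  | Scale a f => a * ev lam f
  | VComp g f => ev lam g * ev lam f
  | HComp g f => ev (act (src f) lam) g * ev lam f
  end.

(** * Support of the scalars *)

Lemma typed_act lam u v d f : typed lam u v d f -> act u lam = act v lam.
Proof.
elim=> {lam u v d f} //=.
- by move=> lam i j; rewrite addrAC.
- by move=> lam i; rewrite addrK.
- by move=> lam i; rewrite addrNK.
- by move=> lam i; rewrite addrK.
- by move=> lam i; rewrite addrNK.
- by move=> lam u v w d e g f _ -> _ ->.
- by move=> lam u u' v v' d e g f _ IHg _ IHf; rewrite !act_cat IHg IHf.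
Qed.

Lemma typed_src lam u v d f : typed lam u v d f -> src f = u.
Proof.
elim=> {lam u v d f} //=.
by move=> lam u u' v v' d e g f _ -> _ ->.
Qed.

(** A nonzero scalar can only join two nonzero spaces. This makes [Id u], which acts by 0 on a dead
    word, a unit for composition. *)
Lemma ev_live lam u v d f : typed lam u v d f ->
  ev lam f != 0 -> live u lam && live v lam.
Proof.
have natr (b : bool) : b%:R != 0 :> rat -> b by case: b; rewrite ?eqxx.
elim=> {lam u v d f} /=; rewrite ?eqxx //.
- by move=> lam u /natr->.
- by move=> lam i /natr->.
- by move=> lam i /natr LV; rewrite LV andbT; case/andP: LV => /andP[].
- by move=> lam i /natr LV; rewrite LV andbT; case/andP: LV => /andP[].
- by move=> lam i /natr LV; rewrite LV /=; case/andP: LV => /andP[].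
- by move=> lam i /natr LV; rewrite LV /=; case/andP: LV => /andP[].
- by move=> lam b i m; rewrite mulf_eq0 negb_or => /andP[/natr-> _].
- move=> lam u v d f g _ IHf _ IHg nz.
  have [f0|/IHf//] := eqVneq (ev lam f) 0.
  by apply: IHg; rewrite f0 add0r in nz.
- by move=> lam u v d a f _ IHf; rewrite mulf_eq0 negb_or => /andP[_ /IHf].
- move=> lam u v w d e g f _ IHg _ IHf; rewrite mulf_eq0 negb_or.
  by case/andP=> /IHg/andP[_ ->] /IHf/andP[->].
- move=> lam u u' v v' d e g f tg IHg tf IHf; rewrite mulf_eq0 negb_or.
  rewrite (typed_src tf) !live_cat -(typed_act tf).
  by case/andP=> /IHg/andP[-> ->] /IHf/andP[-> ->].
Qed.

Lemma ev_dead lam u v d f : typed lam u v d f ->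
  ~~ (live u lam && live v lam) -> ev lam f = 0.
Proof. by move=> tf; apply: contraNeq; apply: ev_live tf. Qed.

Lemma ev_liver lam u v d f : typed lam u v d f ->
  (live u lam)%:R * ev lam f = ev lam f.
Proof.
move=> tf; case: (eqVneq (ev lam f) 0) => [->|/(ev_live tf)/andP[-> _]].
  by rewrite mulr0.
by rewrite mul1r.
Qed.

Lemma ev_livel lam u v d f : typed lam u v d f ->
  (live v lam)%:R * ev lam f = ev lam f.
Proof.
move=> tf; case: (eqVneq (ev lam f) 0) => [->|/(ev_live tf)/andP[_ ->]].
  by rewrite mulr0.
by rewrite mul1r.
Qed.

(** * Invariance under the axioms and relations *)

Lemma typed_IdI lam u v d w : typed lam u v d (Id w) -> u = w /\ v = w.
Proof. by move=> t; inversion t. Qed.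

Lemma typed_vcompI lam u w d (g f : tm n) : typed lam u w d (g \vo f) ->
  exists v d1 d2, typed lam u v d1 f /\ typed lam v w d2 g.
Proof. by move=> t; inversion t; subst; do 3!eexists; split; eassumption. Qed.

Lemma typed_hcompI lam u v d (g f : tm n) : typed lam u v d (g \ho f) ->
  exists u1 u2 v1 v2 d1 d2,
    [/\ typed lam u1 v1 d1 f, typed (act u1 lam) u2 v2 d2 g,
        u = u2 ++ u1 & v = v2 ++ v1].
Proof.
by move=> t; inversion t; subst; do 6!eexists; split; try eassumption.
Qed.

Lemma typed_addI lam u v d (f g : tm n) : typed lam u v d (Add f g) ->
  typed lam u v d f /\ typed lam u v d g.
Proof. by move=> t; inversion t. Qed.

(** The linear axioms are ring identities; the unit laws rest on [ev_live], and interchange on the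
    two ends of a diagram leading to the same weight. *)
Lemma ev_struct lam u v d (f g : tm n) : struct_ax f g ->
  typed lam u v d f -> typed lam u v d g -> ev lam f = ev lam g.
Proof.
case=> {f g} /=; try by (intros; ring).
- move=> w f tf tf'; have [x [? [? [_ /typed_IdI[_ <-]]]]] := typed_vcompI tf.
  exact: ev_livel tf'.
- move=> w f tf tf'; have [x [? [? [/typed_IdI[<- _] _]]]] := typed_vcompI tf.
  by rewrite mulrC; exact: ev_liver tf'.
- by move=> f g h _ _; rewrite act_cat mulrA.
- move=> f _ tf; rewrite (typed_src tf) mulrC.
  case: (eqVneq (ev lam f) 0) => [->|/(ev_live tf)]; first by rewrite mul0r.
  by case/andP=> /live_tgt-> _; rewrite mulr1.
- move=> f _ tf; case: (eqVneq (ev lam f) 0) => [->|/(ev_live tf)].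
    by rewrite mul0r.
  by case/andP=> /live_src-> _; rewrite mulr1.
- move=> f g h /typed_hcompI[? [? [? [? [? [? [tfg _ _ _]]]]]]] _.
  have [tf tg] := typed_addI tfg.
  by rewrite mulrDr !(typed_src tf, typed_src tg).
- by move=> u' v' _ _; rewrite live_cat; case: (live _ _); case: (live _ _).
- move=> f f' g g' _ /typed_hcompI[u1 [_ [v1 [_ [? [? [tf _ _ _]]]]]]].
  have [w [? [? [t1 t2]]]] := typed_vcompI tf.
  rewrite (typed_src t1) (typed_src t2) (typed_act t1); ring.
Qed.

Lemma ev_sum lam u v d (I : finType) (Q : pred I) (G : I -> tm n) :
  ev lam (\big[@Add n/Zero u v d]_(a | Q a) G a) = \sum_(a | Q a) ev lam (G a).
Proof. by apply: (big_morph (ev lam)). Qed.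

Lemma typed_dots lam i m : typed lam [:: E i] [:: E i] (2 * m%:Z) (dots i m).
Proof.
elim: m => [|m IH]; first by rewrite mulr0; apply: typed_id.
by rewrite intS mulrDr mulr1 addrC; apply: typed_vcomp IH; apply: typed_dot.
Qed.

Lemma ev_dots lam i m : ev lam (dots i m) = (live [:: E i] lam)%:R.
Proof.
elim: m => [|m] //=.
by rewrite -/(dots i m) => ->; rewrite -natrM mulnb /= andbb.
Qed.

(** The two bubble series are [u - 1] and [(1 - u)^-1] in some order, or [-1] and [1]; their product
    is -1, the value of [kappa] in the target. *)
Lemma bub_series (l : int) (m : nat) : [\/ l = 1, l = 0 | l = -1] ->
  \sum_(a < m.+1) bub false l a%:Z * bub true l (m - a)%N%:Z =
  if m == 0%N then -1 else 0.
Proof.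
case: m => [|m]; first by rewrite big_ord1 => -[] ->.
case=> ->.
(* The counterclockwise series is [u - 1], so only the first two terms survive; for [l = -1] it is
   the clockwise one, and the last two survive. *)
- rewrite !big_ord_recl big1 => [|a _]; last by rewrite !lift0 /bub /= mul0r.
  by rewrite /bub /= !mulr1 addr0 addNr.
- rewrite big_ord_recl big1 => [|a _]; last first.
    by rewrite lift0 /bub /= andbF mul0r.
  by rewrite /bub /= andbF mulr0 addr0.
- rewrite !big_ord_recr /= big1 => [|a _].
    by rewrite subSnn subnn /bub /= add0r mulr1 mul1r addrN.
  have -> : (m.+1 - a = (m - a.+1).+2)%N by have := ltn_ord a; lia.
  by rewrite /bub /= mulr0.
Qed.

Lemma ev_triple_sum lam w (l : int) (G : nat -> nat -> nat -> tm n) :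
  [\/ l = 1, l = 0 | l = -1] ->
  ev lam (triple_sum w l G) = if l == 1 then ev lam (G 0 0 0)%N else 0.
Proof.
case=> ->; rewrite /triple_sum ?big_ord0 //=.
  by rewrite !(ev_sum, big_ord1) big_mkcond big_ord1.
(* For [l = -1] each index has one value, 0, but the condition [a + b + c = -2] excludes it. *)
by rewrite !(ev_sum, big_ord1) big1.
Qed.

Lemma vertex_bar_cases lam i : vertex lam ->
  [\/ bar lam i = 1, bar lam i = 0 | bar lam i = -1].
Proof.
by case/(vertex_bar i) => -[-> _]; [constructor 1|constructor 2|constructor 3].
Qed.

(** Liveness would give [j = i + 1] and [i = j + 1], hence [i = i + 2]. *)
Lemma not_live_EEE i j lam : ~~ live [:: E i; E j; E i] lam.
Proof.
apply/negP; rewrite -[[:: _; _; _]]/([:: E i] ++ [:: E j; E i]) live_cat.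
case/andP=> LE LEE; have [ij _] := live_EE LEE.
have : live [:: E i; E j] (act [:: E i] lam).
  by move: LE LEE => /= /andP[-> ->] /andP[/andP[_ ->] _].
by case/live_EE => ji _; move: (ordSS_neq i); rewrite -ji -ij eqxx.
Qed.

Arguments live u lam : simpl never.

(** A syntactic test for vanishing: every summand contains a crossing or a zero. *)
Fixpoint crossing (f : tm n) : bool :=
  match f with
  | Cross _ _ | Zero _ _ _ => true
  | Add f g => crossing f && crossing g
  | Scale _ f => crossing f
  | VComp g f | HComp g f => crossing g || crossing f
  | _ => false
  end.

Lemma ev_crossing lam f : crossing f -> ev lam f = 0.
Proof.
elim: f lam => //= [f IHf g IHg|a f IHf|g IHg f IHf|g IHg f IHf] lam.
- by case/andP=> /IHf-> /IHg->; rewrite addr0.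
- by move/IHf->; rewrite mulr0.
- by case/orP=> [/IHg|/IHf] ->; rewrite (mul0r, mulr0).
- by case/orP=> [/IHg|/IHf] ->; rewrite (mul0r, mulr0).
Qed.

Lemma ev_whisk lam u v w (f : tm n) : src f = w ->
  (forall mu, ev mu f = (live w mu)%:R) ->
  ev lam (whisk u f v) = (live (u ++ w ++ v) lam)%:R.
Proof.
move=> fw fE; rewrite !live_cat /= fw fE act_cat.
by do 3!case: (live _ _).
Qed.

Lemma src_dots i m : src (dots i m) = [:: E i].
Proof. by elim: m. Qed.

Lemma ev_km lam u v d (f g : tm n) : km_rel (Utilde n) lam f g ->
  typed lam u v d f -> typed lam u v d g -> ev lam f = ev lam g.
Proof.
have nat_and (a b : bool) : a%:R * b%:R = (a && b)%:R :> rat.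
  by rewrite -natrM mulnb.
case=> {f g}.
- move=> i _ _; rewrite /= !nat_and /live /= ?(addrK, addrNK).
  by case: (vertex lam); case: (vertex (lam + shift1 _)).
- move=> i _ _; rewrite /= !nat_and /live /= ?(addrK, addrNK).
  by case: (vertex lam); case: (vertex (lam + shift1 _)).
- move=> i _ _; rewrite /= !nat_and /live /= ?(addrK, addrNK).
  by case: (vertex lam); case: (vertex (lam + shift1 _)).
- move=> i _ _; rewrite /= !nat_and /live /= ?(addrK, addrNK).
  by case: (vertex lam); case: (vertex (lam + shift1 _)).
- move=> i _ _; rewrite /= !nat_and /live /= ?(addrK, addrNK).
  by case: (vertex lam); case: (vertex (lam + shift1 _)).
- by move=> i j _ _; rewrite !ev_crossing.
- by move=> i j _ _; rewrite !ev_crossing.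
- by move=> i j _ _; rewrite !ev_crossing.
- by move=> i _ _; rewrite ev_crossing.
(* The word is live only for [j = ordS i], where [ip i j] is -1 and not 0. *)
- move=> i j ij _ _; rewrite ev_crossing //=.
  case: (boolP (live _ _)) => [/live_EE[ji _]|_]; last by rewrite mulr0.
  by move: ij; rewrite ji ip_ordS.
- move=> i j ij _ _; rewrite [LHS]ev_crossing //.
  have e1 : ev lam (whisk [::] (Defs.Dot i) [:: E j]) =
      (live [:: E i; E j] lam)%:R.
    exact: (@ev_whisk lam [::] [:: E j] [:: E i]).
  have e2 : ev lam (whisk [:: E i] (Defs.Dot j) [::]) =
      (live [:: E i; E j] lam)%:R.
    exact: (@ev_whisk lam [:: E i] [::] [:: E j]).
  transitivity (tilde_t i j * (live [:: E i; E j] lam)%:R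
    + tilde_t j i * (live [:: E i; E j] lam)%:R); last by rewrite -{1}e1 -e2.
  (* Both dots act by 1 on the live word, and [t_(i,i+1) + t_(i+1,i) = -1 + 1 = 0]. *)
  case: (boolP (live _ _)) => [/live_EE[-> _]|_]; last by rewrite !mulr0.
  rewrite /tilde_t eqxx orbT (eq_sym i) (negPf (ordS_neq _)) //.
  by rewrite (eq_sym i) (negPf (ordSS_neq _)).
- move=> i _ _; rewrite ev_crossing //=.
  by case: (boolP (live _ _)) => // /live_EE[/eqP]; rewrite ordS_eqFr.
- move=> i _ _; rewrite ev_crossing //=.
  by case: (boolP (live _ _)) => // /live_EE[/eqP]; rewrite ordS_eqFr.
- by move=> i j _ _ _; rewrite ev_crossing.
- by move=> i j _ _ _; rewrite ev_crossing.
- move=> i j _ _ _; rewrite ev_crossing //=.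
  by rewrite (negPf (not_live_EEE _ _ _)) mulr0.
- by move=> i j k _ _ _; rewrite ev_crossing.
(* The real bubble acts by 1 if [bar lam i = 1]. If [bar lam i] is 0 or -1 it acts by 0, and its
   index [d0 + 1] or [d0 + 2] is past the last term of the series [1] or [u - 1]. *)
- move=> i d0 _ _.
  have := @ev_whisk lam [::] [:: F i] _ _ (src_dots i d0)
    (fun mu => ev_dots mu i d0).
  move: (whisk _ _ _) => g /= ->; rewrite live_EF_bar //.
  case: (boolP (vertex lam)) => [lamV|]; last by rewrite !mul0r.
  case: (vertex_bar_cases i lamV) => -> /=.
  - by rewrite addrK /bub eqxx !mul1r.
  - by rewrite subr0 !(mul0r, mul1r) addrC -intS /bub /= andbF.
  - by rewrite opprK !(mul0r, mul1r) !(addrC _ 1) -!intS /bub.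
- move=> i d0 _ _.
  have := @ev_whisk lam [:: F i] [::] _ _ (src_dots i d0)
    (fun mu => ev_dots mu i d0).
  move: (whisk _ _ _) => g /= ->; rewrite live_FE_bar //.
  case: (boolP (vertex lam)) => [lamV|]; last by rewrite !mul0r.
  case: (vertex_bar_cases i lamV) => -> /=.
  - by rewrite !(mul0r, mul1r) !(addrC _ 1) -!intS /bub.
  - by rewrite addr0 !(mul0r, mul1r) addrC -intS /bub /= andbF.
  - by rewrite addrK /bub eqxx !mul1r.
- move=> b i0 m m_lt0 _ _; rewrite /= /bub.
  case: (boolP (vertex lam)) => [lamV|]; last by rewrite !mul0r.
  case: (vertex_bar_cases i0 lamV) => ->; case: b; case: m m_lt0 => //.
(* The coordinate at [ordS i] is 1 if [bar lam i = -1] and 0 otherwise, so [tilde_c] gives the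
   constant terms of the series. *)
- move=> b i _ _; rewrite /= /live /= /tilde_c.
  case: (boolP (vertex lam)) => [lamV|]; last by rewrite mul0r mulr0.
  by rewrite mulr1 mul1r; case: (vertex_bar i lamV) => -[-> ->]; case: b.
- move=> i m _ _; rewrite ev_sum.
  case: (boolP (vertex lam)) => [lamV|/negPf lamV].
    transitivity (\sum_(a < m.+1)
      bub false (bar lam i) a%:Z * bub true (bar lam i) (m - a)%N%:Z).
      by apply: eq_bigr => a _; rewrite /= lamV !mul1r.
    rewrite (bub_series _ (vertex_bar_cases i lamV)); case: m => //=.
    by rewrite /live lamV mulr1.
  rewrite big1 => [|a _]; last by rewrite /= lamV !mul0r.
  by case: m => //=; rewrite /live lamV mulr0.
- move=> i j ij _ _; rewrite ev_crossing //=.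
  by case: (boolP (live _ _)) => // /live_EF e; rewrite e eqxx in ij.
- move=> i j ij _ _; rewrite ev_crossing //=.
  by case: (boolP (live _ _)) => // /live_FE e; rewrite e eqxx in ij.
(* The word is live only for [bar lam i = 1]; then [- kappa = 1] cancels the only summand, whose
   bubble has value -1. *)
- move=> i _ _; rewrite ev_crossing // [RHS]/=.
  have dE (m : nat) := @ev_whisk lam [::] [:: F i] _ _ (src_dots i m)
    (fun mu => ev_dots mu i m).
  case: (boolP (vertex lam)) => [lamV|lamV].
    rewrite (ev_triple_sum _ _ _ (vertex_bar_cases i lamV)) live_EF_bar // lamV.
    case: eqP => [lamE|_] /=; last by rewrite mulr0.
    have LE : live [:: E i; F i] lam by rewrite live_EF_bar // lamV lamE.
    move: (dE 0%N); rewrite /= LE lamV lamE => ->.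
    by rewrite !mulr1 /bub /= !(mulr1, mul1r) opprK subrr.
  rewrite live_EF_bar // (negPf lamV) mulr0 add0r.
  rewrite /triple_sum ev_sum big1 // => a _.
  rewrite ev_sum big1 // => b _; rewrite ev_sum big1 // => c _ /=.
  by rewrite (negPf lamV) !(mul0r, mulr0).
- move=> i _ _; rewrite ev_crossing // [RHS]/=.
  have dE (m : nat) := @ev_whisk lam [:: F i] [::] _ _ (src_dots i m)
    (fun mu => ev_dots mu i m).
  case: (boolP (vertex lam)) => [lamV|lamV].
    have barN : [\/ - bar lam i = 1, - bar lam i = 0 | - bar lam i = -1].
      case: (vertex_bar_cases i lamV) => ->;
        by [constructor 3|constructor 2|constructor 1].
    rewrite (ev_triple_sum _ _ _ barN) live_FE_bar // lamV eqr_oppLR.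
    case: eqP => [lamE|_] /=; last by rewrite mulr0.
    have LE : live [:: F i; E i] lam by rewrite live_FE_bar // lamV lamE.
    move: (dE 0%N); rewrite /= LE lamV lamE => ->.
    by rewrite !mulr1 /bub /= !(mulr1, mul1r) opprK subrr.
  rewrite live_FE_bar // (negPf lamV) mulr0 add0r.
  rewrite /triple_sum ev_sum big1 // => a _.
  rewrite ev_sum big1 // => b _; rewrite ev_sum big1 // => c _ /=.
  by rewrite (negPf lamV) !(mul0r, mulr0).
Qed.

Lemma eqv_typed (P : kmparam n) lam u v d (f g : tm n) :
  eqv P lam u v d f g -> typed lam u v d f /\ typed lam u v d g.
Proof.
elim=> {lam u v d f g}; try by [].
- by move=> lam u v d f g _ [].
- by move=> lam u v d f g h _ [? _] _ [].
- by move=> lam u v d f f' g g' _ [? ?] _ [? ?]; split; apply: typed_add.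
- by move=> lam u v d a f f' _ [? ?]; split; apply: typed_scale.
- move=> lam u v w d e f f' g g' _ [tg tg'] _ [tf tf'].
  by split; [apply: typed_vcomp tg tf|apply: typed_vcomp tg' tf'].
- move=> lam u u' v v' d e f f' g g' _ [tg tg'] _ [tf tf'].
  by split; [apply: typed_hcomp tg tf|apply: typed_hcomp tg' tf'].
Qed.

Theorem ev_eqv lam u v d (f g : tm n) :
  eqv (Utilde n) lam u v d f g -> ev lam f = ev lam g.
Proof.
elim=> {lam u v d f g} //=.
- by move=> lam u v d f g; apply: ev_struct.
- by move=> lam u v d f g; apply: ev_km.
- by move=> lam u v d f g h _ -> _ ->.
- by move=> lam u v d f f' g g' _ -> _ ->.
- by move=> lam u v d a f f' _ ->.
- by move=> lam u v w d e f f' g g' _ -> _ ->.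
(* [ev] places the left factor according to [src], so [f] and [f'] must have the same source. *)
- move=> lam u u' v v' d e f f' g g' _ e1 /eqv_typed[tf tf'] e2.
  by rewrite /= (typed_src tf) (typed_src tf') e1 e2.
Qed.

(** * Pulling back along a 2-functor *)

Section PulledBackRepresentation.
Variables (P : kmparam n) (Xi : twofunctor P (Utilde n)).

(** The proof component is a boolean equality, hence irrelevant. This identifies the one-summand
    1-morphisms hidden in different instances of [pval]. *)
Lemma mor1_eq lam mu (X Y : mor1 lam mu) : X = Y :> seq _ -> X = Y.
Proof.
case: X Y => [X HX] [Y HY] /= XY; rewrite -XY in HY *.
by congr Mor1; apply: bool_irrelevance.
Qed.

Lemma mor1_singleton lam mu (X : mor1 lam mu) u r :
  X = [:: (u, r)] :> seq _ -> mu = act u lam.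
Proof. by case: X => X HX /= XE; move: HX; rewrite XE /= andbT => /eqP. Qed.

(* [f], as a 2-morphism [u<r> -> v<s>], is mapped by [Xi] to a 2-morphism acting
   by the scalar [q] on the natural representation. *)
Definition pval lam u v (r s : int) (f : tm n) (q : rat) : Prop :=
  exists mu (X Y : mor1 lam mu) (phi : mor2 X Y),
    [/\ X = [:: (u, r)] :> seq _, Y = [:: (v, s)] :> seq _, phi 0%N 0%N = f &
        ev lam (fun2 Xi phi 0%N 0%N) = q].

Lemma pval_typed lam u v r s f q :
  pval lam u v r s f q -> typed lam u v (s - r) f.
Proof.
case=> mu [X [Y [phi [XE YE <- _]]]].
have := entryP phi (i := 0%N) (j := 0%N).
rewrite /wd /sh XE YE; exact.
Qed.

Lemma pval_dead lam u v r s f q : pval lam u v r s f q ->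
  ~~ (live u lam && live v lam) -> q = 0.
Proof.
case=> mu [X [Y [phi [XE YE _ <-]]]]; apply: ev_dead.
have := entryP (fun2 Xi phi) (i := 0%N) (j := 0%N).
rewrite /wd /sh XE YE; exact.
Qed.

(** [Xi] respects [eq2] and [ev] respects equality in the target, so the scalar depends only on the
    class of [f]. *)
Lemma pval_eqv_inj lam u v r s f g a b : pval lam u v r s f a ->
  pval lam u v r s g b -> eqv P lam u v (s - r) f g -> a = b.
Proof.
case=> mu [X [Y [phi [XE YE <- <-]]]] [mu' [X' [Y' [phi' [XE' YE' <- <-]]]]] fg.
have muE : mu' = mu by rewrite (mor1_singleton XE') (mor1_singleton XE).
subst mu'; have EX : X' = X by apply: mor1_eq; rewrite XE.
have EY : Y' = Y by apply: mor1_eq; rewrite YE.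
subst X' Y'; have E2 : eq2 P phi phi'.
  by rewrite /eq2 /wd /sh XE YE => -[|i] [|j].
have := fun2_ext Xi E2 (i := 0%N) (j := 0%N); rewrite XE YE => /(_ isT isT).
exact: ev_eqv.
Qed.

Lemma pval_inj lam u v r s f a b :
  pval lam u v r s f a -> pval lam u v r s f b -> a = b.
Proof.
by move=> fa fb; apply: pval_eqv_inj fa fb (eqv_refl P (pval_typed fa)).
Qed.

Lemma pval_ex lam u v r s f : typed lam u v (s - r) f ->
  exists q, pval lam u v r s f q.
Proof.
move=> tf; have pu : all (fun x => act x.1 lam == act u lam) [:: (u, r)].
  by rewrite /= eqxx.
have pv : all (fun x => act x.1 lam == act u lam) [:: (v, s)].
  by rewrite /= (typed_act tf) eqxx.
have pf (i j : nat) : (i < size (Mor1 pu))%N -> (j < size (Mor1 pv))%N ->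
  typed lam (wd (Mor1 pu) i) (wd (Mor1 pv) j)
    (sh (Mor1 pv) j - sh (Mor1 pu) i) f.
  by case: i => [|i] //; case: j => [|j].
exists (ev lam (fun2 Xi (Mor2 pf) 0%N 0%N)).
by exists (act u lam), (Mor1 pu), (Mor1 pv), (Mor2 pf).
Qed.

Lemma pval_eqv lam u v r s f g q :
  eqv P lam u v (s - r) f g -> pval lam u v r s f q -> pval lam u v r s g q.
Proof.
move=> fg fq; have [q' gq'] := pval_ex (proj2 (eqv_typed fg)).
by rewrite (pval_eqv_inj fq gq' fg).
Qed.

Lemma pval_id lam u r : pval lam u u r r (Id u) (live u lam)%:R.
Proof.
have pu : all (fun x => act x.1 lam == act u lam) [:: (u, r)].
  by rewrite /= eqxx.
exists (act u lam), (Mor1 pu), (Mor1 pu), (id2 (Mor1 pu)); split=> //.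
by have /ev_eqv -> := fun2_id Xi (X := Mor1 pu) (i := 0%N) (j := 0%N) isT isT.
Qed.

Lemma pval_add lam u v r s f g a b : pval lam u v r s f a ->
  pval lam u v r s g b -> pval lam u v r s (Add f g) (a + b).
Proof.
case=> mu [X [Y [phi [XE YE <- <-]]]] [mu' [X' [Y' [phi' [XE' YE' <- <-]]]]].
have muE : mu' = mu by rewrite (mor1_singleton XE') (mor1_singleton XE).
subst mu'; have EX : X' = X by apply: mor1_eq; rewrite XE.
have EY : Y' = Y by apply: mor1_eq; rewrite YE.
subst X' Y'; exists mu, X, Y, (add2 phi phi'); split=> //.
have := fun2_add Xi phi phi' (i := 0%N) (j := 0%N); rewrite XE YE.
by move=> /(_ isT isT)/ev_eqv->.
Qed.

Lemma pval_scale lam u v r s f a q : pval lam u v r s f q ->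
  pval lam u v r s (Scale a f) (a * q).
Proof.
case=> mu [X [Y [phi [XE YE <- <-]]]].
exists mu, X, Y, (scale2 a phi); split=> //.
have := fun2_scale Xi a phi (i := 0%N) (j := 0%N); rewrite XE YE.
by move=> /(_ isT isT)/ev_eqv->.
Qed.

Lemma pval_zero lam u v r s : act u lam = act v lam ->
  pval lam u v r s (Zero u v (s - r)) 0.
Proof.
move=> uv; have tz : typed lam u v (s - r) (Zero u v (s - r)).
  exact: typed_zero.
have [q zq] := pval_ex tz; have := pval_scale 0 zq; rewrite mul0r.
apply: pval_eqv; apply: eqv_struct => //; last exact: typed_scale.
exact: ax_scale0.
Qed.

Lemma pval_vcomp lam u v w r s t g f b a : pval lam v w s t g b ->
  pval lam u v r s f a -> pval lam u w r t (g \vo f) (b * a).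
Proof.
move=> gb fa; have tg := pval_typed gb; have tf := pval_typed fa.
have tgf : typed lam u w (t - r) (g \vo f).
  have -> : t - r = (s - r) + (t - s) by ring.
  exact: typed_vcomp tg tf.
(* The product of two 1 by 1 matrices is a sum over one index ending in a [Zero], which is stripped
   afterwards. *)
have : pval lam u w r t (Add (g \vo f) (Zero u w (t - r))) (b * a).
  case: fa => mu [X [Y [phi [XE YE <- <-]]]].
  case: gb => mu' [Y' [Z' [psi [YE' ZE' <- <-]]]].
  have muE : mu' = mu by rewrite (mor1_singleton YE') (mor1_singleton YE).
  subst mu'; have EY : Y' = Y by apply: mor1_eq; rewrite YE.
  subst Y'; exists mu, X, Z', (vcomp2 psi phi); split=> //.
    by rewrite /= /wd /sh XE YE ZE' big_ord_recl big_ord0.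
  have := fun2_vcomp Xi psi phi (i := 0%N) (j := 0%N); rewrite XE ZE'.
  move=> /(_ isT isT)/ev_eqv->; rewrite /= ev_sum YE big_ord1 //.
have uw : act u lam = act w lam by rewrite (typed_act tf) (typed_act tg).
have tz : typed lam u w (t - r) (Zero u w (t - r)) by apply: typed_zero.
apply: pval_eqv.
apply: (@eqv_trans _ _ _ _ _ _ _ (Add (Zero u w (t - r)) (g \vo f))).
  by apply: eqv_struct (ax_addC _ _) _ _; apply: typed_add.
by apply: eqv_struct (ax_add0 _ _ _ _) _ _ => //; apply: typed_add.
Qed.

Lemma pval_hcomp lam u u' v v' r s r' s' g f b a :
  pval (act v lam) u u' r s g b -> pval lam v v' r' s' f a ->
  pval lam (u ++ v) (u' ++ v') (r + r') (s + s') (g \ho f) (b * a).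
Proof.
move=> gb [mu [X [X' [phi [XE XE' <- <-]]]]].
have muE := mor1_singleton XE; subst mu.
case: gb => nu [Y [Y' [psi [YE YE' <- <-]]]].
exists nu, (comp1 Y X), (comp1 Y' X'), (hcomp2 psi phi).
have tphi := entryP (fun2 Xi phi) (i := 0%N) (j := 0%N); move: tphi.
rewrite /wd /sh XE XE' => /(_ isT isT) tphi.
have := fun2_hcomp Xi psi phi (i := 0%N) (j := 0%N).
rewrite /= XE YE XE' YE' => /(_ isT isT)/ev_eqv evE; split=> //.
by rewrite evE /= (typed_src tphi).
Qed.

Lemma typed_deg lam u v d d' (f : tm n) :
  typed lam u v d f -> d = d' -> typed lam u v d' f.
Proof. by move=> + <-. Qed.

Lemma typed_dotI lam u v d i : typed lam u v d (Defs.Dot i) -> d = 2.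
Proof. by move=> t; inversion t. Qed.

Lemma pval_whisk lam u w w' v r s (f : tm n) q :
  pval (act v lam) w w' r s f q ->
  pval lam (u ++ w ++ v) (u ++ w' ++ v) r s (whisk u f v)
    ((live u (act (w ++ v) lam))%:R * (q * (live v lam)%:R)).
Proof.
move=> fq.
have := pval_hcomp (pval_id (act (w ++ v) lam) u 0)
  (pval_hcomp fq (pval_id lam v 0)).
by rewrite !addr0 !add0r.
Qed.

Lemma ip_ordSl i : ip (ordS i) i = -1.
Proof.
by rewrite ipE // eqxx ordS_eqF // (negPf (ordSS_neq i)).
Qed.

(* The middle object of the double crossing of strands [j, j + 1] vanishes. *)
Lemma pval_dot_step j r a b :
  pval (fund (ordS j)) [:: E j] [:: E j] r (r + 2) (Defs.Dot j) a ->
  pval (fund (ordS (ordS j))) [:: E (ordS j)] [:: E (ordS j)] r (r + 2)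
    (Defs.Dot (ordS j)) b ->
  tpar P j (ordS j) * a + tpar P (ordS j) j * b = 0.
Proof.
set k := ordS j; set lam := fund (ordS k) => va vb.
have LV : live [:: E j; E k] lam := live_fund_EE j.
have va' : pval lam [:: E j; E k] [:: E j; E k] r (r + 2)
    (whisk [::] (Defs.Dot j) [:: E k]) a.
  have va2 : pval (act [:: E k] lam) [:: E j] [:: E j] r (r + 2) (Defs.Dot j) a.
    by rewrite act_E.
  have := pval_whisk [::] va2; rewrite live_fund_E [live [::] _](live_tgt LV).
  by rewrite mul1r mulr1.
have vb' : pval lam [:: E j; E k] [:: E j; E k] r (r + 2)
    (whisk [:: E j] (Defs.Dot k) [::]) b.
  have := @pval_whisk lam [:: E j] _ _ [::] _ _ _ _ vb.
  by rewrite [act _ _]act_E live_fund_E [live [::] _](live_src LV) mul1r mulr1.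
have [c1 v1] : exists q,
    pval lam [:: E j; E k] [:: E k; E j] r (r + 1) (Cross j k) q.
  apply: pval_ex; apply: typed_deg; first exact: typed_cross.
  by rewrite ip_ordS // opprK; ring.
have [c2 v2] : exists q,
    pval lam [:: E k; E j] [:: E j; E k] (r + 1) (r + 2) (Cross k j) q.
  apply: pval_ex; apply: typed_deg; first exact: typed_cross.
  by rewrite ip_ordSl // opprK; ring.
have c10 : c1 = 0.
  apply: (pval_dead v1); rewrite negb_and; apply/orP; right; apply/negP.
  by case/live_EE => /eqP; rewrite eq_sym (negPf (ordSS_neq j)).
have vrhs := pval_add (pval_scale (tpar P j k) va')
  (pval_scale (tpar P k j) vb').
have vlhs := pval_vcomp v2 v1.
have <- := pval_eqv_inj vlhs vrhs.
  by rewrite c10 mulr0.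
apply: eqv_km (pval_typed vlhs) (pval_typed vrhs).
exact: quadratic_near (ip_ordS j).
Qed.

(** * Vanishing in nonzero degree when the dots vanish *)

Hypothesis dot0 : forall lam i r s q,
  pval lam [:: E i] [:: E i] r s (Defs.Dot i) q -> q = 0.

Lemma pval_dots0 lam i (m : nat) r s q : (0 < m)%N -> s - r = 2 * m%:Z ->
  pval lam [:: E i] [:: E i] r s (dots i m) q -> q = 0.
Proof.
case: m => // m _ sr vq.
have [a va] : exists a, pval lam [:: E i] [:: E i] r (s - 2) (dots i m) a.
  by apply: pval_ex; apply: typed_deg (typed_dots _ _ _) _; lia.
have [b vb] : exists b, pval lam [:: E i] [:: E i] (s - 2) s (Defs.Dot i) b.
  by apply: pval_ex; apply: typed_deg (typed_dot _ _) _; ring.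
by rewrite (pval_inj vq (pval_vcomp vb va)) (dot0 vb) mul0r.
Qed.

(** If [E i F i] is dead, the cup vanishes. Otherwise [bar lam i = 1], and the bubble carries a dot,
    which vanishes. *)
Lemma pval_cw_real lam i (m : nat) r s q : (bar lam i = 1 -> (0 < m)%N) ->
  s - r = 2 * (m%:Z + 1 - bar lam i) ->
  pval lam [::] [::] r s (Bub true i (m%:Z + 1 - bar lam i)) q -> q = 0.
Proof.
move=> m_gt0 sr vq; pose t := 1 - bar lam i.
have [a va] : exists a, pval lam [::] [:: E i; F i] r (r + t) (LCup i) a.
  by apply: pval_ex; apply: typed_deg (typed_lcup _ _) _; rewrite /t; ring.
have [b vb] : exists b, pval (act [:: F i] lam) [:: E i] [:: E i] (r + t)
    (r + t + 2 * m%:Z) (dots i m) b.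
  by apply: pval_ex; apply: typed_deg (typed_dots _ _ _) _; ring.
have [c vc] : exists c,
    pval lam [:: E i; F i] [::] (r + t + 2 * m%:Z) s (RCap i) c.
  by apply: pval_ex; apply: typed_deg (typed_rcap _ _) _; rewrite /t; lia.
have vd := pval_vcomp vc (pval_vcomp (pval_whisk [::] vb) va).
rewrite -(pval_eqv_inj vd vq); last first.
  by apply: eqv_km (bubble_cw _ _ _ _) (pval_typed vd) (pval_typed vq).
case: (boolP (live [:: E i; F i] lam)) => [|dead].
  rewrite live_EF_bar // => /andP[_ /eqP/m_gt0 m0].
  by rewrite (pval_dots0 m0 _ vb) ?(mul0r, mulr0) //; ring.
by rewrite (pval_dead va) ?mulr0 // (negPf dead) andbF.
Qed.

Lemma pval_ccw_real lam i (m : nat) r s q : (bar lam i = -1 -> (0 < m)%N) ->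
  s - r = 2 * (m%:Z + 1 + bar lam i) ->
  pval lam [::] [::] r s (Bub false i (m%:Z + 1 + bar lam i)) q -> q = 0.
Proof.
move=> m_gt0 sr vq; pose t := 1 + bar lam i.
have [a va] : exists a, pval lam [::] [:: F i; E i] r (r + t) (RCup i) a.
  by apply: pval_ex; apply: typed_deg (typed_rcup _ _) _; rewrite /t; ring.
have [b vb] : exists b, pval (act [::] lam) [:: E i] [:: E i] (r + t)
    (r + t + 2 * m%:Z) (dots i m) b.
  by apply: pval_ex; apply: typed_deg (typed_dots _ _ _) _; ring.
have [c vc] : exists c,
    pval lam [:: F i; E i] [::] (r + t + 2 * m%:Z) s (LCap i) c.
  by apply: pval_ex; apply: typed_deg (typed_lcap _ _) _; rewrite /t; lia.
have vd := pval_vcomp vc (pval_vcomp (pval_whisk [:: F i] vb) va).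
rewrite -(pval_eqv_inj vd vq); last first.
  by apply: eqv_km (bubble_ccw _ _ _ _) (pval_typed vd) (pval_typed vq).
case: (boolP (live [:: F i; E i] lam)) => [|dead].
  rewrite live_FE_bar // => /andP[_ /eqP/m_gt0 m0].
  by rewrite (pval_dots0 m0 _ vb) ?(mul0r, mulr0) //; ring.
by rewrite (pval_dead va) ?mulr0 // (negPf dead) andbF.
Qed.

Lemma pval_bub0 lam b i r : vertex lam ->
  pval lam [::] [::] r r (Bub b i 0) (cpar P b i lam).
Proof.
move=> lamV; have := pval_scale (cpar P b i lam) (pval_id lam [::] r).
rewrite /live lamV mulr1; move=> vq; apply: pval_eqv (vq) => //.
apply: eqv_sym; apply: eqv_km (bubble_0 _ _ _ _) _ (pval_typed vq).
by apply: typed_deg (typed_bub _ _ _ _) _; ring.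
Qed.

(** The coefficient of [u] in the bubble series relation. *)
Lemma pval_bub1 lam i r s x y : vertex lam -> s = r + 2 ->
  pval lam [::] [::] r s (Bub false i 1) x ->
  pval lam [::] [::] r s (Bub true i 1) y ->
  cpar P false i lam * y + x * cpar P true i lam = 0.
Proof.
move=> lamV sr vx vy.
have v0 := pval_zero (u := [::]) (v := [::]) r s (erefl (act [::] lam)).
have vl := pval_add (pval_vcomp (pval_bub0 false i s lamV) vy)
  (pval_add (pval_vcomp vx (pval_bub0 true i r lamV)) v0).
rewrite addr0 in vl; apply: (pval_eqv_inj vl v0).
have R := bubble_series P lam i 1; rewrite !big_ord_recl big_ord0 /= in R.
have -> : s - r = 2 * 1%:Z by rewrite sr; ring.
apply: eqv_km.
- exact: R.
- by have := pval_typed vl; have -> : s - r = 2 * 1%:Z by rewrite sr; ring.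
- by have := pval_typed v0; have -> : s - r = 2 * 1%:Z by rewrite sr; ring.
Qed.

(** As [bar lam i] is -1, 0 or 1, all bubbles with [m >= 2] are real. For [m = 1] a fake bubble is
    tied to its real partner by [pval_bub1]. *)
Lemma pval_bub lam b i (m : int) r s q : m != 0 -> s - r = 2 * m ->
  pval lam [::] [::] r s (Bub b i m) q -> q = 0.
Proof.
move=> m0 sr vq.
case: (boolP (vertex lam)) => [lamV|dead]; last first.
  by apply: (pval_dead vq); rewrite negb_and dead.
have [m_lt0|m_ge0] := ltP m 0.
  have v0 := pval_zero (u := [::]) (v := [::]) r s (erefl (act [::] lam)).
  apply: (pval_eqv_inj vq v0).
  apply: eqv_km _ (pval_typed vq) (pval_typed v0).
  by rewrite sr; apply: bubble_neg.
have bar_cases := vertex_bar_cases i lamV.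
have cw (d : nat) : (bar lam i = 1 -> (0 < d)%N) ->
    m = d%:Z + 1 - bar lam i -> b = true -> q = 0.
  move=> d0 mE bE; apply: (@pval_cw_real lam i d r s) => //; rewrite -mE //.
  by rewrite -bE.
have ccw (d : nat) : (bar lam i = -1 -> (0 < d)%N) ->
    m = d%:Z + 1 + bar lam i -> b = false -> q = 0.
  move=> d0 mE bE; apply: (@pval_ccw_real lam i d r s) => //; rewrite -mE //.
  by rewrite -bE.
have [m1|m1] := eqVneq m 1; last first.
  case: b vq cw ccw => vq cw ccw.
    apply: (cw (absz (m - 1 + bar lam i)%R)) => //.
      by case: bar_cases => ->; lia.
    by case: bar_cases => ->; lia.
  apply: (ccw (absz (m - 1 - bar lam i)%R)) => //.
    by case: bar_cases => ->; lia.
  by case: bar_cases => ->; lia.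
have s2 : s = r + 2 by lia.
have [x vx] : exists x, pval lam [::] [::] r s (Bub false i 1) x.
  by apply: pval_ex; apply: typed_deg (typed_bub _ _ _ _) _; lia.
have [y vy] : exists y, pval lam [::] [::] r s (Bub true i 1) y.
  by apply: pval_ex; apply: typed_deg (typed_bub _ _ _ _) _; lia.
have xy := pval_bub1 lamV s2 vx vy.
have xq : b = false -> q = x.
  by move=> bE; apply: pval_inj vq _ => //; rewrite bE m1.
have yq : b = true -> q = y.
  by move=> bE; apply: pval_inj vq _ => //; rewrite bE m1.
(* For [bar lam i = 1] the clockwise bubble has one dot and the other is fake; for -1 the roles are
   swapped; for 0 both are real, without dots. *)
case: bar_cases => barE.
- have y0 : y = 0.
    apply: (@pval_cw_real lam i 1 r s) => //; rewrite barE //; first by lia.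
  case: b xq yq {vq cw ccw} => [_ ->//|-> // _].
  move: xy; rewrite y0 mulr0 add0r => /eqP.
  rewrite mulf_eq0 (negPf (cpar_neq0 _ _ _ _)).
  by rewrite orbF => /eqP.
- case: b vq cw ccw {xq yq} => vq cw ccw.
    by apply: (cw 0%N) => //; rewrite barE; lia.
  by apply: (ccw 0%N) => //; rewrite barE; lia.
- have x0 : x = 0.
    apply: (@pval_ccw_real lam i 1 r s) => //; rewrite barE //; first by lia.
  case: b xq yq {vq cw ccw} => [_ -> //|-> //].
  move: xy; rewrite x0 mul0r addr0 => /eqP.
  rewrite mulf_eq0 (negPf (cpar_neq0 _ _ _ _)).
  by move=> /eqP.
Qed.

(** Live cups and caps have degree 0, the two ends of a crossing are never both live, and a
    composite of nonzero degree has a factor of nonzero degree. *)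
Lemma pval_degree lam u v d (f : tm n) : typed lam u v d f -> d != 0 ->
  forall r s q, s - r = d -> pval lam u v r s f q -> q = 0.
Proof.
elim=> {lam u v d f}.
- by [].
- by move=> lam i _ r s q _; apply: dot0.
- move=> lam i j _ r s q _ vq; apply: (pval_dead vq); apply/negP.
  case/andP=> /live_EE[-> _] /live_EE[/eqP].
  by rewrite eq_sym (negPf (ordSS_neq i)).
- move=> lam i d0 r s q _ vq; apply: (pval_dead vq); apply: contraNN d0.
  by rewrite live_FE_bar // => /and3P[_ _ /eqP->].
- move=> lam i d0 r s q _ vq; apply: (pval_dead vq); apply: contraNN d0.
  by rewrite live_EF_bar // => /and3P[_ _ /eqP->].
- move=> lam i d0 r s q _ vq; apply: (pval_dead vq); apply: contraNN d0.
  by rewrite live_FE_bar // => /andP[/andP[_ /eqP->]].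
- move=> lam i d0 r s q _ vq; apply: (pval_dead vq); apply: contraNN d0.
  by rewrite live_EF_bar // => /andP[/andP[_ /eqP->]].
- move=> lam b i m; rewrite mulf_eq0 negb_or => /andP[_ m0] r s q.
  exact: pval_bub.
- move=> lam u v d uv d0 r s q sr; rewrite -sr => vq.
  exact: (pval_inj vq (pval_zero r s uv)).
- move=> lam u v d f g tf IHf tg IHg d0 r s q sr vq.
  move: tf tg; rewrite -sr => /pval_ex[a va] /pval_ex[b vb].
  rewrite (pval_inj vq (pval_add va vb)).
  by rewrite (IHf d0 _ _ _ sr va) (IHg d0 _ _ _ sr vb) addr0.
- move=> lam u v d a f tf IHf d0 r s q sr vq.
  move: tf; rewrite -sr => /pval_ex[b vb].
  rewrite (pval_inj vq (pval_scale a vb)).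
  by rewrite (IHf d0 _ _ _ sr vb) mulr0.
- move=> lam u v w d e g f tg IHg tf IHf de0 r s q sr vq.
  have rd : (r + d) - r = d by ring.
  have se : s - (r + d) = e by rewrite opprD addrA sr; ring.
  move: tf tg; rewrite -{1}rd -{1}se => /pval_ex[a va] /pval_ex[b vb].
  rewrite (pval_inj vq (pval_vcomp vb va)).
  have [d0|d0] := eqVneq d 0; last by rewrite (IHf d0 _ _ _ rd va) mulr0.
  by rewrite d0 add0r in de0; rewrite (IHg de0 _ _ _ se vb) mul0r.
- move=> lam u u' v v' d e g f tg IHg tf IHf de0 r s q sr vq.
  (* Shifts add up in a horizontal composite: one factor goes from [r] to [r + d], the other from 0
     to [e]. *)
  have rd : (r + d) - r = d by ring.
  have se : e - 0 = e by rewrite subr0.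
  move: tf tg; rewrite -{1}rd -{1}se => /pval_ex[a va] /pval_ex[b vb].
  have := pval_hcomp vb va; rewrite addr0.
  have -> : r + d + e = s by rewrite -addrA -sr; ring.
  move=> vba; rewrite (pval_inj vq vba).
  have [d0|d0] := eqVneq d 0; last by rewrite (IHg d0 _ _ _ rd vb) mul0r.
  by rewrite d0 add0r in de0; rewrite (IHf de0 _ _ _ se va) mulr0.
Qed.

End PulledBackRepresentation.

(** * Signs of the scalars *)

Lemma sum_alpha : \sum_i alpha i = 0 :> weight n.
Proof.
rewrite sumrB [X in X - _](reindex (@ordS n)) ?subrr //.
by exists (@ord_pred n) => i _; [exact: ordSK|exact: ord_predK].
Qed.

Lemma bubble_sum_alpha (Q : scalar_choice n) i lam (s : seq 'I_n) :
  bubble Q true i (lam + \sum_(j <- s) alpha j) =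
  \prod_(j <- s) scal Q i j * bubble Q true i lam.
Proof.
elim: s => [|j s IH]; first by rewrite !big_nil addr0 mul1r.
by rewrite !big_cons addrCA addrC bubble_compat_cw IH mulrA.
Qed.

(** Adding all simple roots, whose sum is 0, multiplies [c^+_i] by this product. *)
Lemma prod_scal (Q : scalar_choice n) i : \prod_j scal Q i j = 1.
Proof.
have := bubble_sum_alpha Q i 0 (index_enum 'I_n); rewrite sum_alpha addr0.
by rewrite -[LHS]mul1r => /(mulIf (bubble_neq0 _ _ _ _)).
Qed.

Definition far i j := [&& j != i, j != ordS i & i != ordS j].

Lemma farC i j : far i j = far j i.
Proof. by rewrite /far eq_sym [(j != ordS i) && _]andbC. Qed.

(** Each unordered far pair contributes [t i j] times [t j i], the square of [t i j]. *)
Lemma prod_far (t : 'I_n -> 'I_n -> rat) :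
  (forall i j, far i j -> t i j = t j i) ->
  \prod_i \prod_(j | far i j) t i j =
  (\prod_i \prod_(j | far i j && (i < j)%N) t i j) ^+ 2.
Proof.
move=> tC; rewrite expr2 -[X in _ = _ * X](_ :
  \prod_i \prod_(j | far i j && (j < i)%N) t i j = _).
  rewrite -big_split; apply: eq_bigr => i _ /=.
  rewrite (bigID (fun j : 'I_n => (i < j)%N)) /=; congr (_ * _).
  apply: eq_bigl => j; case: (boolP (far i j)) => //= /andP[ji _].
  by rewrite -leqNgt leq_eqVlt [_ == _](negPf ji).
rewrite (exchange_big_dep predT) //=; apply: eq_bigr => i _.
by apply: eq_big => j; [rewrite farC|case/andP=> /tC].
Qed.

(** In the product of all [t i j] the diagonal part is 1 and the far part a nonzero square. *)
Lemma prod_adjacent_gt0 (t : 'I_n -> 'I_n -> rat) :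
  (forall i j, t i j != 0) -> (forall i, t i i = 1) ->
  (forall i j, far i j -> t i j = t j i) -> \prod_i \prod_j t i j = 1 ->
  0 < \prod_i t i (ordS i) * \prod_i t (ordS i) i.
Proof.
move=> t_neq0 t_diag tC.
have predE : \prod_i t (ordS i) i = \prod_i t i (ord_pred i).
  rewrite [RHS](reindex (@ordS n)).
    by under [RHS]eq_bigr do rewrite ordSK.
  by exists (@ord_pred n) => j _; [exact: ordSK|exact: ord_predK].
have rowE i : \prod_j t i j =
    t i (ordS i) * t i (ord_pred i) * \prod_(j | far i j) t i j.
  have pE : i = ordS (ord_pred i) by rewrite ord_predK.
  rewrite (bigD1 i) //= t_diag mul1r (bigD1 (ordS i)) ?ordS_neq //=.
  rewrite (bigD1 (ord_pred i)) /= ?mulrA.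
    congr (_ * _); apply: eq_bigl => j; rewrite /far -andbA.
    congr [&& _, _ & _].
    by rewrite [X in _ = (X != _)]pE (inj_eq (@ordS_inj n)) eq_sym.
  apply/andP; split; apply/eqP => e.
    by move: (ordS_neq (ord_pred i)); rewrite -pE -{1}e eqxx.
  by move: (ordSS_neq (ord_pred i)); rewrite -pE e eqxx.
under eq_bigr do rewrite rowE.
rewrite !big_split /= -predE prod_far // => e.
have : 0 < \prod_i t i (ordS i) * \prod_i t (ordS i) i *
    (\prod_i \prod_(j | far i j && (i < j)%N) t i j) ^+ 2 by rewrite e.
rewrite pmulr_lgt0 // lt_neqAle sqr_ge0 andbT eq_sym expf_neq0 //.
by do 2!apply/prodf_neq0 => ? _.
Qed.

Lemma iter_ordS_onto i j : exists m, j = iter m (@ordS n) i.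
Proof.
have iterE m : iter m (@ordS n) i = ((i + m) %% n)%N :> nat.
  elim: m => [|m IH]; first by rewrite addn0 modn_small.
  by rewrite iterS /= IH addnS -addn1 modnDml addn1.
(* [n - i] steps lead from [i] to 0, and [j] more to [j]. *)
exists (n - i + j)%N; apply/val_inj; rewrite /= iterE addnA subnKC.
  by rewrite modnDl modn_small.
exact: ltnW.
Qed.

(** Multiplying [t_i a_i = - s_i a_(i+1)] around the cycle gives [T A = - S A] for the products [T],
    [S], [A], as [n] is odd. Since [T] and [S] have the same sign, [A = 0]. *)
Lemma cyclic_vanish (t s a : 'I_n -> rat) : odd n ->
  0 < \prod_i t i * \prod_i s i ->
  (forall i, t i * a i + s i * a (ordS i) = 0) -> forall i, a i = 0.
Proof.
move=> n_odd ts_gt0 rel.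
have s_neq0 i : s i != 0.
  have := lt0r_neq0 ts_gt0; rewrite mulf_eq0 negb_or => /andP[_].
  by move/prodf_neq0; apply.
have : (\prod_i t i + \prod_i s i) * \prod_i a i = 0.
  have aE : \prod_i a i = \prod_i a (ordS i).
    rewrite [LHS](reindex (@ordS n)) //.
    by exists (@ord_pred n) => j _; [exact: ordSK|exact: ord_predK].
  rewrite mulrDl -big_split [X in _ + _ * X]aE -big_split /=.
  rewrite [X in _ + X](eq_bigr (fun i => - (t i * a i))) => [|i _]; last first.
    by rewrite (addr0_eq (rel i)).
  by rewrite prodrN card_ord -signr_odd n_odd mulN1r subrr.
move/eqP; rewrite mulf_eq0.
case/orP=> [/eqP/addr0_eq tsE|/prodf_eq0[i0 _ /eqP a0] i].
  by move: ts_gt0; rewrite -tsE mulrN oppr_gt0 ltNge -expr2 sqr_ge0.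
(* One zero spreads around the cycle because every [s i] is nonzero. *)
have [m ->] := iter_ordS_onto i0 i; elim: m => //= m IH.
have := rel (iter m (@ordS n) i0); rewrite IH mulr0 add0r => /eqP.
by rewrite mulf_eq0 (negPf (s_neq0 _)) => /eqP.
Qed.

Lemma scal_adjacent_gt0 (Q : scalar_choice n) :
  0 < \prod_i scal Q i (ordS i) * \prod_i scal Q (ordS i) i.
Proof.
apply: prod_adjacent_gt0 => //; [exact: scal_neq0|exact: scal_diag| |].
  by move=> i j /and3P[_]; apply: scal_sym.
by rewrite big1 // => i _; apply: prod_scal.
Qed.

(** * Dots under the 2-isomorphism *)

Lemma pval_dot0 (Q : scalar_choice n) (Xi : twofunctor (UQ Q) (Utilde n))
    lam i r s q : odd n ->
  pval Xi lam [:: E i] [:: E i] r s (Defs.Dot i) q -> q = 0.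
Proof.
move=> n_odd vq; have sr : s = r + 2.
  by rewrite -(typed_dotI (pval_typed vq)) addrC subrK.
case: (boolP (live [:: E i] lam)) => [/live_E lamE|dead]; last first.
  by apply: (pval_dead vq); rewrite negb_and dead.
(* All dots are taken between the shifts [r] and [r + 2] of the given one, so that the relations
   close up around the cycle. *)
have /fin_all_exists[a va] j : exists q,
    pval Xi (fund (ordS j)) [:: E j] [:: E j] r (r + 2) (Defs.Dot j) q.
  by apply: pval_ex; apply: typed_deg (typed_dot _ _) _; ring.
rewrite lamE sr in vq; rewrite (pval_inj vq (va i)).
apply: (cyclic_vanish n_odd (scal_adjacent_gt0 Q)) => j.
exact: (pval_dot_step (va j) (va (ordS j))).
Qed.

(** [f] is the entry of the image of the dot under [Psi]; [Xi] takes it back to the dot, which acts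
    by 1 over [e_(i+1)]. *)
Lemma pval_dot_preimage (P : kmparam n) (Xi : twofunctor P (Utilde n))
    (Psi : twofunctor (Utilde n) P) i :
  (forall lam mu (X Y : mor1 lam mu) (f : mor2 X Y),
    eq2 (Utilde n) (fun2 Xi (fun2 Psi f)) f) ->
  exists f, pval Xi (fund (ordS i)) [:: E i] [:: E i] 0 2 f 1.
Proof.
move=> XiPsi; set lam := fund (ordS i).
have p r : all (fun x => act x.1 lam == act [:: E i] lam)
    [:: ([:: E i], r : int)].
  by rewrite /= eqxx.
pose X := Mor1 (p 0); pose Y := Mor1 (p 2).
have pf (a b : nat) : (a < size X)%N -> (b < size Y)%N ->
  typed lam (wd X a) (wd Y b) (sh Y b - sh X a) (Defs.Dot i).
  by case: a => [|a] //; case: b => [|b] // _ _; exact: typed_dot.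
exists (fun2 Psi (Mor2 pf) 0%N 0%N).
exists (act [:: E i] lam), X, Y, (fun2 Psi (Mor2 pf)); split=> //.
have := XiPsi _ _ _ _ (Mor2 pf) 0%N 0%N isT isT => /ev_eqv->.
have L : (live [:: E i] lam)%:R = 1 :> rat by rewrite live_fund_E.
exact: L.
Qed.

End NoTwoIsomorphism.

Theorem theoremA2 (n : nat) (n_ge3 : 3 <= n) (n_odd : odd n)
    (Q : scalar_choice n) :
  ~ (exists Xi : twofunctor (UQ Q) (Utilde n), is_2isomorphism Xi).
Proof.
case=> Xi [Psi [_ XiPsi]].
have i : 'I_n by exists 0; lia.
have [f fq] := pval_dot_preimage n_ge3 i XiPsi.
have dot0 lam j r s q := @pval_dot0 _ n_ge3 Q Xi lam j r s q n_odd.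
(* [f] has degree 2, so its scalar 1 would have to be 0. *)
have /eqP := pval_degree n_ge3 dot0 (pval_typed fq) isT erefl fq.
by rewrite GRing.oner_eq0.
Qed.
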